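(* Let $f(x)=\frac12x^\top Ax-b^\top x$ on $\mathbb{R}^n$, with $A$ symmetric having eigenvalues $a_1,\dots,a_n\in[\mu,L]$, $0<\mu\le L$, and minimizer $x^\star=A^{-1}b$. Let $\alpha\ge1$, $\gamma>0$, and let $(x_k,v_k)$ be generated by the constant-stepsize fully implicit scheme with isotropic noise described in the context, with eigen-coordinates $e_{k,i},w_{k,i}$ as defined there. For each eigen-direction $i$: 1. (Contraction) There exists $C_i=C_i(\mu,L,\gamma)$ such that $$\mathbb{E}\left[e_{k+1,i}^2+w_{k+1,i}^2\,\middle|\,e_{k,i},w_{k,i}\right]\le\frac{C_i}{\alpha^2}\,(e_{k,i}^2+w_{k,i}^2)+\frac{C_i\,\rho^2}{\alpha}.$$ Consequently, summing over $i$ yields the same $O(1/\alpha^2)$ contraction plus $O(1/\alpha)$ noise bound for the full state: with $\bar C=\max_iC_i$ and $\sigma^2=n\rho^2$, $\mathbb{E}[\|e_{k+1}\|^2+\|w_{k+1}\|^2\mid e_k,w_k]\le\frac{\bar C}{\alpha^2}(\|e_k\|^2+\|w_k\|^2)+\frac{\bar C\sigma^2}{\alpha}$; and therefore there exist $G,C>0$ independent of $\alpha$ and $\theta=\Theta(1/\alpha)$ such that $V_k:=\mathbb{E}\|x_k-x^\star\|^2+\theta\,\mathbb{E}\|x_{k-1}-x^\star\|^2$ satisfies $V_{k+1}\le\frac{G}{\alpha}V_k+\frac{C\sigma^2}{\alpha}$ for all $k\ge1$. 2. (Asymptotic explicit constant) For all sufficiently large $\alpha$, the linear recursion is stable and admits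 a stationary law. Denoting by $x_\infty$ the corresponding stationary position variable, $$\lim_{\alpha\to\infty}\alpha\cdot\mathbb{E}\|x_\infty-x^\star\|^2=\rho^2\gamma^2\sum_{i=1}^n\frac1{a_i^2}=\frac{\gamma^2}{n}\,\sigma^2\,\mathrm{tr}(A^{-2}).$$ Thus the stationary mean-square error decays exactly like $C_{\mathrm{quad}}/\alpha$ with $C_{\mathrm{quad}}=(\gamma^2/n)\,\sigma^2\,\mathrm{tr}(A^{-2})$.
   Context: For $\lambda>0$, $\mathrm{prox}_{\lambda f}(z)=\arg\min_x\{\lambda f(x)+\frac12\|x-z\|^2\}$. Scheme (constant $\alpha\ge1$, fixed $\gamma>0$): $\tau=\frac1\alpha+\frac\mu\gamma$, $\lambda=\frac{\alpha}{\gamma(1+\tau)}$; given $x_0,v_0\in\mathbb{R}^n$, for $k\ge0$, $$c_k=\frac{v_k+\tau x_k}{1+\tau},\quad x_{k+1}=\mathrm{prox}_{\lambda f}(c_k+\xi_k),\quad v_{k+1}=x_{k+1}+\frac{x_{k+1}-x_k}{\alpha},\quad \xi_k=\frac{\sqrt\alpha\,\rho}{1+\tau}\,\eta_k,$$ with $\eta_k\sim\mathcal N(0,I_n)$ independent (isotropic noise $\Sigma=\rho^2I_n$, so $\sigma^2:=\mathrm{tr}(\Sigma)=n\rho^2$). Eigen-coordinates: write $A=Q\,\mathrm{diag}(a_1,\dots,a_n)\,Q^\top$ with $Q$ orthogonal, $e_k=Q^\top(x_k-x^\star)$, $w_k=Q^\top(v_k-x^\star)$, $\xi_{k,i}=(Q^\top\xi_k)_i$,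 $r_i=\frac1{1+\lambda a_i}$. Then each coordinate obeys the linear stochastic recursion $$e_{k+1,i}=\frac{r_i}{1+\tau}w_{k,i}+\frac{r_i\tau}{1+\tau}e_{k,i}+r_i\xi_{k,i},\qquad w_{k+1,i}=\Big(\frac1\alpha+1\Big)e_{k+1,i}-\frac1\alpha e_{k,i},$$ with $\mathbb{E}[\xi_{k,i}]=0$, $\mathbb{E}[\xi_{k,i}^2]=\alpha\rho^2/(1+\tau)^2$. ''Stable'' means the transition matrix of this linear recursion has spectral radius less than $1$. $\theta=\Theta(1/\alpha)$ means $\theta\alpha$ is bounded above and below by positive constants independent of $\alpha$. *)

(* Defs.v *)
From HB Require Import structures.
From mathcomp Require Import all_boot all_order all_algebra.
From mathcomp Require Import all_classical all_reals all_analysis.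
From mathcomp Require Import ring lra.
From mathcomp Require Import complex.

Set Implicit Arguments.
Unset Strict Implicit.
Unset Printing Implicit Defensive.

Import Order.TTheory GRing.Theory Num.Theory.
Import numFieldNormedType.Exports.

Local Open Scope classical_set_scope.
Local Open Scope ring_scope.

(* The library has no measurable structure on matrices; as for [n.-tuple T],
   take the sigma-algebra generated by the entries.  For ['cV[R]_n] this is the
   Borel sigma-algebra of R^n. *)
Definition measure_matrix_display : measure_display -> measure_display.
Proof. exact. Qed.

Section measurable_matrix.
Context {d} {T : measurableType d} (m n : nat).

Definition matrix_sigma : set (set 'M[T]_(m, n)) :=
  <<s \bigcup_(ij : 'I_m * 'I_n)
        preimage_set_system setT (fun M : 'M[T]_(m, n) => M ij.1 ij.2)
          measurable >>.

Let matrix_set0 : matrix_sigma set0.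
Proof. exact: sigma_algebra0. Qed.

Let matrix_setC A : matrix_sigma A -> matrix_sigma (~` A).
Proof. exact: sigma_algebraC. Qed.

Let matrix_bigcup (F : _^nat) : (forall i, matrix_sigma (F i)) ->
  matrix_sigma (\bigcup_i (F i)).
Proof. exact: sigma_algebra_bigcup. Qed.

HB.instance Definition _ := @isMeasurable.Build (measure_matrix_display d)
  'M[T]_(m, n) matrix_sigma matrix_set0 matrix_setC matrix_bigcup.

End measurable_matrix.

Section probability_notions.
Context {d} {Omega : measurableType d} {R : realType}.
Variable P : probability Omega R.

Definition mutually_independent {I : eqType} (F : I -> set (set Omega)) :=
  forall (J : seq I) (B : I -> set Omega), uniq J ->
    (forall j, j \in J -> F j (B j)) ->
    P (\bigcap_(j in [set` J]) B j) = (\prod_(j <- J) fine (P (B j)))%:E.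

Definition std_gaussian_vector n (X : {RV P >-> 'cV[R]_n}) :=
  (forall i (U : set R), measurable U ->
     P ((fun omega => X omega i 0) @^-1` U) = normal_prob 0 1 U) /\
  mutually_independent
    (fun i : 'I_n => g_sigma_algebra_preimage (fun omega => X omega i 0)).

Definition iid_std_gaussian n (eta : nat -> {RV P >-> 'cV[R]_n}) :=
  (forall k, std_gaussian_vector (eta k)) /\
  mutually_independent (fun k => g_sigma_algebra_preimage (eta k)).

(* [Z] is a version of E[X | Y]. *)
Definition is_cond_expectation d' (T : measurableType d') (Y : Omega -> T)
    (X Z : Omega -> R) :=
  [/\ P.-integrable setT (EFin \o X),
      P.-integrable setT (EFin \o Z),
      forall U : set R, measurable U ->
        g_sigma_algebra_preimage Y (Z @^-1` U)
    & forall B, g_sigma_algebra_preimage Y B ->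
        (\int[P]_(omega in B) (Z omega)%:E =
         \int[P]_(omega in B) (X omega)%:E)%E].

(* E[X | Y] <= W almost surely. *)
Definition cond_expectation_le d' (T : measurableType d') (Y : Omega -> T)
    (X W : Omega -> R) :=
  (exists Z, is_cond_expectation Y X Z) /\
  (forall Z, is_cond_expectation Y X Z ->
     {ae P, forall omega, Z omega <= W omega}).

End probability_notions.

Section vectors.
Context {R : realType} {n : nat}.

Definition sqnorm (u : 'cV[R]_n) : R := \sum_i u i 0 ^+ 2.

Definition argmin (g : 'cV[R]_n -> R) : 'cV[R]_n :=
  xget 0 [set x | forall y, g x <= g y].

Definition prox (lambda : R) (f : 'cV[R]_n -> R) (z : 'cV[R]_n) : 'cV[R]_n :=
  argmin (fun x => lambda * f x + 2^-1 * sqnorm (x - z)).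

Definition quad (A : 'M[R]_n) (b x : 'cV[R]_n) : R :=
  2^-1 * (x^T *m A *m x) 0 0 - (b^T *m x) 0 0.

Definition orthogonal_diagonalization (A Q : 'M[R]_n) (a : 'rV[R]_n) :=
  [/\ A^T = A, Q^T *m Q = 1%:M & A = Q *m diag_mx a *m Q^T].

End vectors.

Section scheme.
Context {R : realType}.
Variables mu gamma alpha : R.

Definition tau : R := alpha^-1 + mu / gamma.
Definition stepsize : R := alpha / (gamma * (1 + tau)).

Section iteration.
Context {n : nat}.
Variables (rho : R) (f : 'cV[R]_n -> R).

Definition noise (eta : 'cV[R]_n) : 'cV[R]_n :=
  (Num.sqrt alpha * rho / (1 + tau)) *: eta.

(* A state is a pair (x, v). *)
Definition scheme_step (s : 'cV[R]_n * 'cV[R]_n) (eta : 'cV[R]_n) :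
    'cV[R]_n * 'cV[R]_n :=
  let c := (1 + tau)^-1 *: (s.2 + tau *: s.1) in
  let x' := prox stepsize f (c + noise eta) in
  (x', x' + alpha^-1 *: (x' - s.1)).

Fixpoint scheme {Omega : Type} (eta : nat -> Omega -> 'cV[R]_n)
    (x0 v0 : 'cV[R]_n) (k : nat) (omega : Omega) : 'cV[R]_n * 'cV[R]_n :=
  if k is k'.+1 then scheme_step (scheme eta x0 v0 k' omega) (eta k' omega)
  else (x0, v0).

(* [nu] is an invariant law of the Markov chain (x_k, v_k), whose transition
   kernel is [s |-> law of scheme_step s eta]. *)
Definition stationary_law {d} {Omega : measurableType d}
    (P : probability Omega R) (eta : {RV P >-> 'cV[R]_n})
    (nu : probability ('cV[R]_n * 'cV[R]_n)%type R) :=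
  forall B, measurable B ->
    nu B = (\int[nu]_s P [set omega | B (scheme_step s (eta omega))])%E.

End iteration.

(* The linear recursion in an eigen-direction of eigenvalue [a], on row vectors
   (e, w). *)
Definition coord_step (a : R) (s : 'rV[R]_2) (xi : R) : 'rV[R]_2 :=
  let r := (1 + stepsize * a)^-1 in
  let e := s 0 0 in
  let w := s 0 1 in
  let e' := r / (1 + tau) * w + r * tau / (1 + tau) * e + r * xi in
  let w' := (alpha^-1 + 1) * e' - alpha^-1 * e in
  \row_j (if j == 0 then e' else w').

Definition transition_mx (a : R) : 'M[R]_2 :=
  lin1_mx (fun s => coord_step a s 0).

End scheme.

Definition spectral_radius {R : realType} n (M : 'M[R]_n) : R :=
  sup [set complex.Re `|z| | z in
        [set z : R[i] | eigenvalue (map_mx (real_complex R) M) z]].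

Definition stable {R : realType} n (M : 'M[R]_n) := spectral_radius M < 1.

(* [theta = Theta(1/alpha)] on the range alpha >= 1. *)
Definition Theta_inv {R : realType} (theta : R -> R) :=
  exists c1 c2 : R, [/\ 0 < c1, 0 < c2 &
    forall alpha, 1 <= alpha -> c1 <= theta alpha * alpha <= c2].

(* Eigen-coordinates of the scheme for [quad A b]: [e_k = Q^T (x_k - xstar)] and
   [w_k = Q^T (v_k - xstar)]. *)
Section quadratic.
Context {R : realType} {n : nat} {Omega : Type}.
Variables (mu gamma alpha rho : R) (A Q : 'M[R]_n) (b : 'cV[R]_n).
Variables (eta : nat -> Omega -> 'cV[R]_n) (x0 v0 : 'cV[R]_n).

Definition xstar : 'cV[R]_n := invmx A *m b.

Definition quad_scheme := scheme mu gamma alpha rho (quad A b) eta x0 v0.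

Definition ecoord (k : nat) (omega : Omega) : 'cV[R]_n :=
  Q^T *m ((quad_scheme k omega).1 - xstar).

Definition wcoord (k : nat) (omega : Omega) : 'cV[R]_n :=
  Q^T *m ((quad_scheme k omega).2 - xstar).

End quadratic.

(* Consistency of the definitions: [xstar] minimizes the objective, [prox] is the
   resolvent, and the eigen-coordinates of the scheme follow [coord_step]. *)
Section sanity.
Context {R : realType} {n : nat}.
Variables (A Q : 'M[R]_n) (a : 'rV[R]_n) (b : 'cV[R]_n).
Hypothesis diagA : orthogonal_diagonalization A Q a.
Hypothesis a_gt0 : forall i, 0 < a 0 i.

Let dot (u v : 'cV[R]_n) : R := (u^T *m v) 0 0.

Let dotC u v : dot u v = dot v u.
Proof.
rewrite /dot -[in LHS](trmxK (u^T *m v)) mxE.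
by rewrite trmx_mul trmxK.
Qed.

Let dotDl u v w : dot (u + v) w = dot u w + dot v w.
Proof. by rewrite /dot linearD /= mulmxDl mxE. Qed.

Let dotDr u v w : dot w (u + v) = dot w u + dot w v.
Proof. by rewrite /dot mulmxDr mxE. Qed.

Let dotZr k u v : dot u (k *: v) = k * dot u v.
Proof. by rewrite /dot -scalemxAr mxE. Qed.

Let sqnormE (u : 'cV[R]_n) : sqnorm u = dot u u.
Proof.
rewrite /sqnorm /dot mxE; apply: eq_bigr => i _.
by rewrite mxE expr2.
Qed.

Let sqnorm_ge0 (u : 'cV[R]_n) : 0 <= sqnorm u.
Proof. by apply: sumr_ge0 => i _; exact: sqr_ge0. Qed.

Let sqnorm_eq0 (u : 'cV[R]_n) : sqnorm u <= 0 -> u = 0.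
Proof.
move=> u0; apply/matrixP => i j; rewrite ord1 mxE.
have /eqP : sqnorm u = 0 by apply/eqP; rewrite eq_le u0 sqnorm_ge0.
rewrite psumr_eq0 => [/allP/(_ i (mem_index_enum i))|k _]; last exact: sqr_ge0.
by rewrite /= sqrf_eq0 => /eqP.
Qed.

Let QQT : Q *m Q^T = 1%:M.
Proof. by case: diagA => _ QTQ _; exact: mulmx1C. Qed.

Let psdA (h : 'cV[R]_n) : 0 <= dot h (A *m h).
Proof.
case: diagA => _ _ ->.
rewrite /dot !mulmxA -(mulmxA _ Q^T h) -[h^T *m Q]trmxK trmx_mul trmxK.
rewrite mxE; apply: sumr_ge0 => i _.
rewrite mul_mx_diag !mxE mulrAC; apply: mulr_ge0; last exact/ltW.
by rewrite -expr2 sqr_ge0.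
Qed.

Let quadD (p h : 'cV[R]_n) :
  quad A b (p + h) =
  quad A b p + dot h (A *m p - b) + 2^-1 * dot h (A *m h).
Proof.
have sA : dot p (A *m h) = dot h (A *m p).
  rewrite dotC /dot trmx_mul; case: diagA => -> _ _.
  by rewrite mulmxA.
have quadE x : quad A b x = 2^-1 * dot x (A *m x) - dot x b.
  by rewrite /quad [in RHS](dotC x b) /dot mulmxA.
rewrite !quadE mulmxDr !(dotDl, dotDr) sA.
have -> : dot h (- b) = - dot h b by rewrite -scaleN1r dotZr mulN1r.
by field.
Qed.

Let A_unit : A \in unitmx.
Proof.
case: diagA => _ QTQ ->; rewrite !unitmx_mul unitmx_tr.
have -> : Q \in unitmx by have [] := mulmx1_unit QTQ.
rewrite unitmxE det_diag unitfE andbT /=.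
by apply/prodf_neq0 => i _; rewrite gt_eqF.
Qed.

Lemma xstar_minimizer (y : 'cV[R]_n) : quad A b (xstar A b) <= quad A b y.
Proof.
rewrite -[y](subrKC (xstar A b)) quadD {3}/xstar mulKVmx// subrr.
rewrite -[X in _ + dot _ X](scale0r (0 : 'cV[R]_n)) dotZr mul0r addr0 lerDl.
by rewrite mulr_ge0// invr_ge0.
Qed.

Lemma prox_quadP (lambda : R) (z p : 'cV[R]_n) : 0 <= lambda ->
  lambda *: (A *m p - b) + (p - z) = 0 -> prox lambda (quad A b) z = p.
Proof.
move=> lambda0 ep; pose g x := lambda * quad A b x + 2^-1 * sqnorm (x - z).
rewrite -[LHS]/(argmin g) /argmin.
have gD h : g (p + h) = g p + 2^-1 * (lambda * dot h (A *m h) + sqnorm h).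
  have e0 : lambda * dot h (A *m p - b) + dot h (p - z) = 0.
    by rewrite -dotZr -dotDr ep -(scale0r (0 : 'cV[R]_n)) dotZr mul0r.
  rewrite /g quadD addrAC !sqnormE !(dotDl, dotDr) (dotC p h) (dotC (- z) h).
  rewrite !dotDr in e0.
  by move: e0; lra.
have gp y : g p <= g y.
  rewrite -[y](subrKC p) gD lerDl mulr_ge0 ?invr_ge0// addr_ge0//.
  by rewrite mulr_ge0.
case: xgetP => [y _ /= /(_ p)|/(_ p)]; last by move=> /(_ gp).
rewrite -{1}[y](subrKC p) gD => gy; apply/eqP; rewrite -subr_eq0; apply/eqP.
apply: sqnorm_eq0.
have : 0 <= lambda * dot (y - p) (A *m (y - p)) by rewrite mulr_ge0.
by move: gy; lra.
Qed.

Lemma eigen_recursion (mu gamma alpha rho : R) (Omega : Type)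
    (eta : nat -> Omega -> 'cV[R]_n) (x0 v0 : 'cV[R]_n) k omega i :
  0 < mu -> 0 < gamma -> 0 < alpha ->
  let e := ecoord mu gamma alpha rho A Q b eta x0 v0 in
  let w := wcoord mu gamma alpha rho A Q b eta x0 v0 in
  let row e w : 'rV[R]_2 := \row_j (if j == 0 then e else w) in
  row (e k.+1 omega i 0) (w k.+1 omega i 0) =
  coord_step mu gamma alpha (a 0 i) (row (e k omega i 0) (w k omega i 0))
    ((Q^T *m noise mu gamma alpha rho (eta k omega)) i 0).
Proof.
move=> mu0 gamma0 alpha0 e w row.
have tau0 : 0 < 1 + tau mu gamma alpha.
  by rewrite /tau !addr_gt0 ?invr_gt0 ?divr_gt0.
have l0 : 0 < stepsize mu gamma alpha by rewrite divr_gt0// mulr_gt0.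
rewrite /e /w /ecoord /wcoord /quad_scheme /=.
case: (scheme _ _ _ _ _ _ _ _ _ _) => x v /=.
rewrite /scheme_step /=.
set t := tau mu gamma alpha in tau0 *.
set l := stepsize mu gamma alpha in l0 *.
set xi := noise _ _ _ _ _; set z := _ + xi.
pose D := diag_mx (\row_j (1 + l * a 0 j)^-1) : 'M[R]_n.
pose p := xstar A b + Q *m (D *m (Q^T *m (z - xstar A b))).
have QTQ : Q^T *m Q = 1%:M by case: diagA.
have la j : 1 + l * a 0 j != 0 by rewrite gt_eqF// addr_gt0// mulr_gt0.
have proxE y : prox l (quad A b) y =
    xstar A b + Q *m (D *m (Q^T *m (y - xstar A b))).
  apply: prox_quadP; first exact: ltW.
  rewrite mulmxDr {1}/xstar mulKVmx// addrAC subrr add0r.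
  rewrite {1}(_ : A = Q *m diag_mx a *m Q^T); last by case: diagA.
  rewrite -!mulmxA (mulmxA Q^T Q) QTQ mul1mx.
  have -> Y : xstar A b + Y - y = Y - (y - xstar A b).
    by rewrite opprB addrA [Y + _]addrC.
  move: (y - _) => u.
  rewrite -[X in _ - X]mul1mx -QQT -!mulmxA scalemxAr -mulmxBr -mulmxDr.
  rewrite (_ : l *: _ + _ = 0) ?mulmx0//.
  move: (Q^T *m u) => q; apply/matrixP => j j'.
  rewrite /D !mul_diag_mx !mxE.
  by move: (la j) => laj; field.
rewrite proxE -/p.
have e' : (Q^T *m (p - xstar A b)) i 0 =
    (1 + l * a 0 i)^-1 * (Q^T *m (z - xstar A b)) i 0.
  by rewrite /p addrAC subrr add0r mulmxA QTQ mul1mx mul_diag_mx !mxE.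
have ez : (Q^T *m (z - xstar A b)) i 0 = (1 + t)^-1 *
   ((Q^T *m (v - xstar A b)) i 0 + t * (Q^T *m (x - xstar A b)) i 0) +
   (Q^T *m xi) i 0.
  have -> : z - xstar A b = (1 + t)^-1 *:
     ((v - xstar A b) + t *: (x - xstar A b)) + xi.
    rewrite /z addrAC; congr (_ + xi); apply/matrixP => j j'; rewrite !mxE.
    by field; rewrite gt_eqF.
  by rewrite mulmxDr -scalemxAr mulmxDr -scalemxAr !(mxE, mulrDr).
have -> : (Q^T *m (p + alpha^-1 *: (p - x) - xstar A b)) i 0 =
    (alpha^-1 + 1) * (Q^T *m (p - xstar A b)) i 0 -
    alpha^-1 * (Q^T *m (x - xstar A b)) i 0.
  have -> : p + alpha^-1 *: (p - x) - xstar A b =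
    (alpha^-1 + 1) *: (p - xstar A b) - alpha^-1 *: (x - xstar A b).
    by apply/matrixP => j j'; rewrite !mxE; ring.
  by rewrite mulmxBr -!scalemxAr !mxE.
rewrite e' ez /row /coord_step !mxE /= -/t -/l.
apply/matrixP => j j'; rewrite !mxE /=.
have t1 : 1 + t != 0 by rewrite gt_eqF.
move: (la i) (gt_eqF alpha0) => lai /negbT alphaN0.
by case: ifP => _; field; rewrite ?lai ?t1 ?alphaN0.
Qed.

End sanity.

(* Main.v *)
Require Import Defs.
From HB Require Import structures.
From mathcomp Require Import all_boot all_order all_algebra.
From mathcomp Require Import all_classical all_reals all_analysis.
From mathcomp Require Import measurable_realfun ring lra complex.

(** In the eigenbasis of A the proximal step is linear and the coordinates
decouple. Write g = gamma / mu, T = 1 + mu / gamma and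
p = gamma / (gamma (1 + tau) + alpha a), where a is the eigenvalue of the
coordinate at hand. One step of the scheme then reads
  e' = p (w + tau e) + p sqrt(alpha) rho z,    w' = (1 / alpha + 1) e' - e / alpha,
where z is a coordinate of Q^T eta. Everything follows from p <= g / alpha,
tau <= T and alpha p --> gamma / a.

Conditional bounds. As Q is orthogonal and the entries of eta are independent
with mean 0 and variance 1, E (s + c z)^2 = s^2 + c^2 for constants s and c
([orthogonal_second_moment]). The state at time k is a function of the first k
noise vectors, hence independent of the k-th one, so that conditioning on the
state amounts to freezing it while integrating over the noise
([freezing_cond_expectation]). What is left is an inequality between explicit
quadratic polynomials ([step_second_moment_le]), with the same constant K for
all coordinates. Summing over the coordinates and taking expectations bounds
the mean of |e_(k+1)|^2 by means of |e_k|^2 and |w_k|^2. For k >= 1 the vector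
w_k is itself a combination of e_k and e_(k-1), which turns this bound into a
recursion for the Lyapunov function with theta = 1 / alpha
([lyapunov_recursion]).

Stability and existence of a stationary law. Without noise, one step maps the
square of radius m in the (e, w) plane into the square of radius h m with
h = O(1 / alpha) ([coord_map_contract]); hence for large alpha the eigenvalues
of the transition matrix have modulus at most 1/2. A stationary law is the law
of the stationary solution
  s = sum over j >= 0 of (response after j steps to the noise u_j),
u_0 being the most recent noise vector. It is built on the space of noise
sequences. Prepending a fresh noise vector u to a sequence x changes the sum
Phi x into the step of the scheme from Phi x with noise u, and it preserves the
law of a sequence of independent, equally distributed vectors; so the image of
that law under Phi is invariant ([invariant_law_of_fixed_point]).

The limit. A stationary law is not assumed to have moments. Applying invariance
to the truncated energies min k (|e|^2 + |w|^2) gives a finite bound on the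
stationary energy, of order 1 / alpha ([truncated_drift_bound],
[stationary_energy_le]). One more application of invariance, now to
|x - xstar|^2, yields
  E |x - xstar|^2 = D + sum over i of p_i^2 alpha rho^2,
where D, the mean square of the noiseless part, is at most K / alpha^2 times
the energy, hence of order alpha^-3 ([stationary_position]). Multiplying by
alpha and letting alpha tend to infinity gives the stated constant. This holds
for every choice of stationary laws. *)

Set Implicit Arguments.
Unset Strict Implicit.
Unset Printing Implicit Defensive.

Import Order.TTheory GRing.Theory Num.Theory.
Import numFieldNormedType.Exports.

Local Open Scope classical_set_scope.
Local Open Scope ring_scope.

(** * Moments of the standard normal law *)

Section density.
Import HBNNSimple.
Context d (T : measurableType d) (R : realType).
Variables (mu nu : {measure set T -> \bar R}) (g : T -> R).
Hypotheses (mg : measurable_fun setT g) (g0 : forall x, 0 <= g x).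
Hypothesis nuE : forall A, measurable A ->
  nu A = (\int[mu]_(x in A) (g x)%:E)%E.

(** The equality holds by hypothesis for indicators, hence for simple functions
by linearity, and passes to the limit along an increasing sequence of simple
functions by monotone convergence on both sides. *)
Lemma ge0_integral_density (f : T -> \bar R) :
  measurable_fun setT f -> (forall x, 0 <= f x)%E ->
  (\int[nu]_x f x = \int[mu]_x (f x * (g x)%:E))%E.
Proof.
move=> mf f0; pose f_ := nnsfun_approx measurableT mf.
have mEg : measurable_fun setT (EFin \o g) by exact/measurable_EFinP.
transitivity (lim (\int[nu]_x (f_ n x)%:E @[n --> \oo])%E).
  rewrite -monotone_convergence//=.
  - apply: eq_integral => ? /[!inE] xD; apply/esym/cvg_lim => //=.
    exact: cvg_nnsfun_approx.
  - by move=> n; exact/measurable_EFinP/measurable_funTS.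
  - by move=> n ? _; rewrite lee_fin.
  - by move=> ? _ ? ? mn; rewrite lee_fin; exact/lefP/nd_nnsfun_approx.
have -> : (\int[mu]_x (f x * (g x)%:E) =
    lim (\int[mu]_x ((f_ n x)%:E * (g x)%:E) @[n --> \oo]))%E.
  rewrite -monotone_convergence//=.
  - apply: eq_integral => x _; apply/esym/cvg_lim => //=.
    by apply: cvgeZr => //; exact: cvg_nnsfun_approx.
  - move=> n; apply: emeasurable_funM => //.
    exact/measurable_EFinP/measurable_funTS.
  - by move=> n x _; rewrite mule_ge0// lee_fin.
  - move=> x _ m n mn; rewrite lee_wpmul2r ?lee_fin//.
    exact/lefP/nd_nnsfun_approx.
apply: congr_lim; apply/funext => n /=.
(* The simple function f_ n is a combination of indicators of its level sets. *)
rewrite [LHS](_ : _ = sintegral nu (f_ n)); last exact: integralT_nnsfun.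
rewrite sintegralE.
have -> : (\int[mu]_x ((f_ n x)%:E * (g x)%:E) =
    \int[mu]_x (\sum_(y \in range (f_ n))
      (y * \1_(f_ n @^-1` [set y]) x * g x)%:E))%E.
  apply: eq_integral => x _; rewrite fimfunE -EFinM.
  rewrite !fsbig_finite//= sumEFin.
  by rewrite mulr_suml.
rewrite ge0_integral_fsum//; last 2 first.
  - move=> y; apply/measurable_EFinP; apply: measurable_funM => //.
    exact: measurable_funM.
  - move=> y x _; rewrite lee_fin; apply: mulr_ge0 => //.
    rewrite indicE; case: (boolP (x \in _)) => [|_]; rewrite ?mulr0//.
    by move=> /[!inE] <-; rewrite mulr1.
apply: eq_fsbigr => y; rewrite inE => -[x0 _ <-{y}].
set A := f_ n @^-1` _.
have mA : measurable A by exact: measurable_sfunP.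
rewrite nuE// -ge0_integralZl//; last 3 first.
- exact/measurable_funTS.
- by move=> x _; rewrite lee_fin.
- by rewrite lee_fin.
rewrite integral_mkcond; apply: eq_integral => x _; rewrite patchE indicE.
by case: ifPn => _; rewrite ?mulr0 ?mul0r// mulr1 -EFinM.
Qed.

End density.

Section real_integrable.
Context d (T : measurableType d) (R : realType).
Variable (mu : {measure set T -> \bar R}).
Implicit Types f g : T -> R.

Lemma integrable_EFinZ c f : mu.-integrable setT (EFin \o f) ->
  mu.-integrable setT (EFin \o (fun x => c * f x)).
Proof. by move=> /(integrableZl measurableT c). Qed.

Lemma integrable_EFinD f g : mu.-integrable setT (EFin \o f) ->
  mu.-integrable setT (EFin \o g) ->
  mu.-integrable setT (EFin \o (fun x => f x + g x)).
Proof. by move=> fi gi; have := integrableD measurableT fi gi. Qed.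

Lemma integrable_EFinB f g : mu.-integrable setT (EFin \o f) ->
  mu.-integrable setT (EFin \o g) ->
  mu.-integrable setT (EFin \o (fun x => f x - g x)).
Proof. by move=> fi gi; have := integrableB measurableT fi gi. Qed.

End real_integrable.

Section normal_moments.
Context {R : realType}.
Local Notation mu := (@lebesgue_measure R).
Local Notation phi := (@normal_pdf R 0 1).

Let pdfE (m s x : R) : s != 0 -> normal_pdf m s x =
  normal_peak s * expR (- (x - m) ^+ 2 / (s ^+ 2 *+ 2)).
Proof. by move=> s0; rewrite normal_pdfE. Qed.

Let one0 : (1 : R) != 0. Proof. exact: oner_neq0. Qed.

Let peak_scale (s : R) : 0 < s -> s * normal_peak s = normal_peak 1.
Proof.
move=> s0; rewrite /normal_peak expr1n mul1r -mulrnAr sqrtrM ?sqr_ge0//.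
by rewrite sqrtr_sqr gtr0_norm// invfM mulrA divff ?gt_eqF// mul1r.
Qed.

(** The ratio of the density of N(0, s^2) to that of N(0, 1) is, up to the
factor 1 / s, the exponential of (1 - 1 / s^2) x^2 / 2; the bound is
exp u >= 1 + u. Since both densities have mass 1, integrating it constrains the
second moment of N(0, 1) for every s, which replaces an integration by parts. *)
Let scale_le (s x : R) : 0 < s ->
  phi x * (1 + (1 - (s ^+ 2)^-1) / 2 * x ^+ 2) <= s * normal_pdf 0 s x.
Proof.
move=> s0; have sN0 : s != 0 by rewrite gt_eqF.
rewrite !pdfE// [leRHS]mulrA peak_scale// -[leLHS]mulrA ler_wpM2l ?normal_peak_ge0//.
rewrite !subr0.
have -> : expR (- x ^+ 2 / (s ^+ 2 *+ 2)) =
   expR (- x ^+ 2 / (1 ^+ 2 *+ 2)) * expR ((1 - (s ^+ 2)^-1) / 2 * x ^+ 2).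
  by rewrite -expRD; congr expR; field.
by rewrite ler_wpM2l ?expR_ge0// expR_ge1Dx.
Qed.

(** The same comparison with N(m, 1); here the first moment appears. *)
Let shift_le (m x : R) :
  phi x * (1 + m * x - m ^+ 2 / 2) <= normal_pdf m 1 x.
Proof.
rewrite !pdfE// -mulrA ler_wpM2l ?normal_peak_ge0// !subr0.
have -> : expR (- (x - m) ^+ 2 / (1 ^+ 2 *+ 2)) =
   expR (- x ^+ 2 / (1 ^+ 2 *+ 2)) * expR (m * x - m ^+ 2 / 2).
  by rewrite -expRD; congr expR; field.
by rewrite ler_wpM2l ?expR_ge0// -addrA expR_ge1Dx.
Qed.

Let phi0 x : 0 <= phi x. Proof. exact: normal_pdf_ge0. Qed.
Let mphi : measurable_fun setT phi. Proof. exact: measurable_normal_pdf. Qed.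

Let int_pdf m s : mu.-integrable setT (EFin \o normal_pdf m s).
Proof. exact: integrable_normal_pdf. Qed.

(** The comparison at s = 2 dominates x^2 phi x by the density of N(0, 4). *)
Let int_sqr : mu.-integrable setT (EFin \o (fun x => x ^+ 2 * phi x)).
Proof.
apply: (le_integrable (measurableT) _ _ (integrableZl measurableT (16/3) (int_pdf 0 2))).
  by apply/measurable_EFinP/measurable_funM => //; exact: measurable_funX.
move=> x _ /=; rewrite lee_fin !ger0_norm; last 2 first.
- by rewrite mulr_ge0 ?normal_pdf_ge0.
- by rewrite (mulr_ge0 (sqr_ge0 _)).
have := @scale_le 2 x (ltr0n _ _); have := phi0 x.
move: (phi x) (normal_pdf 0 2 x) => a b a0 H.
have -> : 16 / 3 * b = 8 / 3 * (2 * b) by field.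
have : a * (1 + (1 - (2 ^+ 2)^-1) / 2 * x ^+ 2) = a + 3 / 8 * (x ^+ 2 * a).
  by field.
by lra.
Qed.

Let int_id : mu.-integrable setT (EFin \o (fun x => x * phi x)).
Proof.
apply: (le_integrable (measurableT) _ _ (integrableD measurableT (int_pdf 0 1) int_sqr)).
  exact/measurable_EFinP/measurable_funM.
move=> x _ /=; rewrite lee_fin normrM (ger0_norm (phi0 _)) [leRHS]ger0_norm; last first.
  by rewrite addr_ge0// (mulr_ge0 (sqr_ge0 _)).
rewrite -[X in _ <= X + _]mul1r -mulrDl ler_wpM2r//.
have := sqr_ge0 (`|x| - 1); rewrite sqrrB mulr1 expr1n real_normK ?num_real//.
by have := normr_ge0 x; lra.
Qed.

Let m1 := (\int[mu]_x (x * phi x))%R.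
Let m2 := (\int[mu]_x (x ^+ 2 * phi x))%R.

Let int1 (m s : R) : (\int[mu]_x (normal_pdf m s x))%R = 1.
Proof. by rewrite /Rintegral integral_normal_pdf. Qed.

Let m2_bound (s : R) : 0 < s -> 1 + (1 - (s ^+ 2)^-1) / 2 * m2 <= s.
Proof.
move=> s0; set c := _ / 2.
have H : (\int[mu]_x (phi x + c * (x ^+ 2 * phi x)) <= \int[mu]_x (s * normal_pdf 0 s x))%R.
  apply: le_Rintegral => //=.
  - by apply: integrable_EFinD => //; exact: integrable_EFinZ.
  - exact: integrable_EFinZ.
  - by move=> x _; have := scale_le x s0; rewrite -/c; lra.
move: H; rewrite RintegralD//; last exact: integrable_EFinZ.
by rewrite !RintegralZl// !int1 mulr1.
Qed.

(** The bound of [m2_bound] is an equality at s = 1, so its first order terms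
on both sides of s = 1 must agree: s slightly above 1 gives m2 <= 1 and s
slightly below 1 gives m2 >= 1. *)
Let m2E : m2 = 1.
Proof.
have m2_2 (t : R) : 0 < t -> (t - 1) * ((t + 1) * m2 - 2 * t ^+ 2) <= 0.
  move=> t0; have t2 : 0 < t ^+ 2 by rewrite exprn_gt0.
  rewrite -(pmulr_rle0 _ (_ : 0 < 2^-1)) ?invr_gt0// -subr_ge0 sub0r.
  have := ler_wpM2l (ltW t2) (m2_bound t0); rewrite -subr_ge0.
  suff -> : t ^+ 2 * t - t ^+ 2 * (1 + (1 - (t ^+ 2)^-1) / 2 * m2) =
     - (2^-1 * ((t - 1) * ((t + 1) * m2 - 2 * t ^+ 2))) by [].
  by field; rewrite gt_eqF.
apply/eqP; rewrite eq_le; apply/andP; split; apply/ler_addgt0Pr => e e0.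
- have := m2_2 (1 + e / 2) ltac:(lra).
  rewrite addrAC subrr add0r pmulr_rle0 ?divr_gt0// subr_le0 => H.
  have : (1 + e / 2 + 1) * m2 <= (1 + e / 2 + 1) * (1 + e) by nra.
  by rewrite ler_pM2l; lra.
- pose h := Num.min (e / 2) 2^-1.
  have h0 : 0 < h by rewrite lt_min !divr_gt0//=; lra.
  have he : h <= e / 2 by rewrite ge_min lexx.
  have h1 : h <= 2^-1 by rewrite ge_min lexx orbT.
  have := m2_2 (1 - h) ltac:(lra).
  rewrite addrAC subrr add0r mulNr oppr_le0 pmulr_rge0// subr_ge0 => H.
  have : (1 - h + 1) * (1 - 2 * h) <= (1 - h + 1) * m2 by nra.
  by rewrite ler_pM2l; lra.
Qed.

Let m1_bound (m : R) : m * m1 <= m ^+ 2 / 2.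
Proof.
have H : (\int[mu]_x (m * (x * phi x)) <=
    \int[mu]_x (normal_pdf m 1 x - (1 - m ^+ 2 / 2) * phi x))%R.
  apply: le_Rintegral => //=.
  - exact: integrable_EFinZ.
  - by apply: integrable_EFinB => //; exact: integrable_EFinZ.
  - by move=> x _; have := shift_le m x; lra.
move: H; rewrite RintegralB//; last exact: integrable_EFinZ.
by rewrite !RintegralZl// !int1 -/m1; lra.
Qed.

(** The bound m * m1 <= m^2 / 2 at m = m1 already gives m1^2 <= 0. *)
Let m1E : m1 = 0.
Proof.
have H1 := m1_bound m1.
by apply/eqP; rewrite -sqrf_eq0 eq_le sqr_ge0 andbT; nra.
Qed.

Lemma normal_second_moment (s : R) :
  (\int[normal_prob 0 1]_x ((s + x) ^+ 2)%:E = (s ^+ 2 + 1)%:E)%E.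
Proof.
rewrite (@ge0_integral_density _ _ _ mu (normal_prob 0 1) _ mphi phi0)//; last 2 first.
- apply/measurable_EFinP; apply: measurable_funX; exact: measurable_funD.
- by move=> x; rewrite lee_fin sqr_ge0.
have -> : (\int[mu]_x (((s + x) ^+ 2)%:E * (phi x)%:E) =
  \int[mu]_x ((s ^+ 2)%:E * (phi x)%:E + (2 * s)%:E * (x * phi x)%:E +
              (x ^+ 2 * phi x)%:E))%E.
  by apply: eq_integral => x _; rewrite -!EFinM -!EFinD; congr EFin; ring.
have i1 : mu.-integrable setT (fun x => (s ^+ 2)%:E * (phi x)%:E)%E.
  exact: (integrable_EFinZ (s ^+ 2) (int_pdf 0 1)).
have i2 : mu.-integrable setT (fun x => (2 * s)%:E * (x * phi x)%:E)%E.
  exact: (integrable_EFinZ (2 * s) int_id).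
have E1 : (\int[mu]_x (x * phi x)%:E = 0)%E.
  by rewrite -[LHS]fineK ?(integrable_fin_num _ int_id)// -/(Rintegral _ _ _) -/m1 m1E.
have E2 : (\int[mu]_x (x ^+ 2 * phi x)%:E = 1)%E.
  by rewrite -[LHS]fineK ?(integrable_fin_num _ int_sqr)// -/(Rintegral _ _ _) -/m2 m2E.
rewrite integralD//; last exact: integrableD.
rewrite integralD// (integralZl measurableT (int_pdf 0 1)).
by rewrite (integralZl measurableT int_id) /= integral_normal_pdf E1 E2 mule0 mule1 adde0.
Qed.

End normal_moments.

(** * Measurable matrices, laws and independence *)

Section measurable_mx.
Context d (T : measurableType d) d' (U : measurableType d') (m n : nat).

Lemma measurable_fun_mx (f : T -> 'M[U]_(m, n)) :
  (forall i j, measurable_fun setT (fun t => f t i j)) -> measurable_fun setT f.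
Proof.
move=> mf; apply: measurability; first reflexivity.
move=> _ [_ [[i j] _ [C mC <-]] <-] /=.
have := mf i j measurableT C mC.
by rewrite !setTI.
Qed.

Lemma measurable_mx_entry (i : 'I_m) (j : 'I_n) :
  measurable_fun setT (fun M : 'M[U]_(m, n) => M i j).
Proof.
move=> _ C mC; apply: sub_sigma_algebra; exists (i, j) => //.
by exists C.
Qed.

End measurable_mx.

Section law.
Local Open Scope ereal_scope.
Context d d' (T : measurableType d) (T' : measurableType d') (R : realType).
Variables (P : probability T R) (X : T -> T') (mX : measurable_fun setT X).

(** The pushforward measure, bundled as a probability for a map given with a
separate proof of measurability. *)
Definition law : probability T' R :=
  distribution P (HB.pack_for {mfun T >-> T'} X (isMeasurableFun.Build _ _ _ _ _ mX)).

Lemma ge0_integral_law (f : T' -> \bar R) :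
  measurable_fun setT f -> (forall y, 0 <= f y) ->
  \int[law]_y f y = \int[P]_x f (X x).
Proof. by move=> mf f0; rewrite ge0_integral_distribution. Qed.

End law.

Section independence.
Local Open Scope ereal_scope.
Context d (T : measurableType d) (R : realType) (P : probability T R).

(** Both sides are finite measures in A: the restriction of P to C and a
multiple of P. Finite measures that agree on a pi-system containing the whole
space agree on the sigma-algebra that it generates. *)
Lemma independent_g_sigma (G : set (set T)) (C : set T) :
  setI_closed G -> G setT -> G `<=` measurable -> measurable C ->
  (forall A, G A -> P (A `&` C) = P A * P C) ->
  forall A, <<s G >> A -> P (A `&` C) = P A * P C.
Proof.
move=> IG GT Gm mC PG A GA.
have PC : P C = (fine (P C))%:E by rewrite fineK// fin_num_measure.
have pc0 : (0 <= fine (P C))%R by rewrite fine_ge0.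
pose r : {nonneg R} := NngNum pc0.
have rE B : mscale r P B = P B * P C by rewrite /mscale [in RHS]PC muleC.
rewrite -rE -[LHS]/(mrestr P mC A).
apply: (@g_sigma_algebra_measure_unique _ R T G Gm (fun=> setT) _ _
  (mrestr P mC) (mscale r P) IG _ _ A GA) => //.
- by apply/seteqP; split => // x _; exists 0%N.
- by move=> B GB; apply: (etrans (PG _ GB)); rewrite -rE.
- by move=> k; rewrite -[X in X < _]/(P (setT `&` C)) setTI ltey_eq fin_num_measure.
Qed.

Context d1 d2 (T1 : measurableType d1) (T2 : measurableType d2).
Variables (X : T -> T1) (Y : T -> T2).
Hypotheses (mX : measurable_fun setT X) (mY : measurable_fun setT Y).
Hypothesis XY : forall A B, measurable A -> measurable B ->
  P (X @^-1` A `&` Y @^-1` B) = P (X @^-1` A) * P (Y @^-1` B).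

(** Independence says that the law of the pair agrees with the product of the
marginal laws on rectangles, hence everywhere; the formula is then Tonelli. *)
Lemma ge0_integral_independent (g : T1 * T2 -> \bar R) :
  measurable_fun setT g -> (forall z, 0 <= g z) ->
  \int[P]_x g (X x, Y x) = \int[P]_x \int[P]_y g (X x, Y y).
Proof.
move=> mg g0.
have mXY : measurable_fun setT (fun x => (X x, Y x)).
  exact: measurable_fun_pair.
rewrite -(ge0_integral_law P mXY)//.
transitivity (\int[law P mX \x law P mY]_z g z).
  apply: eq_measure_integral => A mA _; apply/esym.
  apply: product_measure_unique => // B C mB mC; exact: XY.
rewrite fubini_tonelli1// ge0_integral_law//.
- apply: eq_integral => x _; rewrite /fubini_F ge0_integral_law//.
  exact: measurableT_comp.
- exact: measurable_fun_fubini_tonelli_F.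
- by move=> x; apply: integral_ge0.
Qed.

End independence.

(** * Recursions driven by independent inputs *)

Section cylinders.
Context (T : Type) d1 (T1 : measurableType d1) (Y : nat -> T -> T1).

(** The events determined by separate conditions on the first k inputs. They
form a pi-system generating the history up to time k. *)
Definition cylinders (k : nat) : set (set T) :=
  [set A | exists2 B : nat -> set T1, (forall j, measurable (B j)) &
     A = \bigcap_(j in `I_k) Y j @^-1` B j].

Lemma cylindersI k : setI_closed (cylinders k).
Proof.
move=> _ _ [B mB ->] [C mC ->]; exists (fun j => B j `&` C j).
  by move=> j; exact: measurableI.
by rewrite -bigcapI; apply: eq_bigcapr => j _; rewrite preimage_setI.
Qed.

Lemma cylindersT k : cylinders k setT.
Proof.
exists (fun=> setT) => //; apply/esym/seteqP; split => // x _ j _ //.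
Qed.

Lemma cylindersS k m : (k <= m)%N -> cylinders k `<=` cylinders m.
Proof.
move=> km _ [B mB ->]; exists (fun j => if (j < k)%N then B j else setT).
  by move=> j; case: ifP.
apply/seteqP; split => x Bx j /= jk.
  by case: ifPn => // jk'; exact: Bx.
by have := Bx j (leq_trans jk km : `I_m j); rewrite /= jk.
Qed.

Lemma cylinders_last k C : measurable C -> cylinders k.+1 (Y k @^-1` C).
Proof.
move=> mC; exists (fun j => if j == k then C else setT).
  by move=> j; case: ifP.
apply/seteqP; split => x Cx; last first.
  by have := Cx k (ltnSn k); rewrite /= eqxx.
by move=> j /= _; case: ifP => // /eqP ->.
Qed.

End cylinders.

Section history.
Local Open Scope ereal_scope.
Context d (T : measurableType d) (R : realType) (P : probability T R).
Context d1 (T1 : measurableType d1) (Y : nat -> T -> T1).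
Hypothesis mY : forall k, measurable_fun setT (Y k).
Local Notation cylinders := (cylinders Y).

Lemma cylinders_measurable k : cylinders k `<=` measurable.
Proof.
move=> _ [B mB ->]; apply: fin_bigcap_measurable; first exact: finite_II.
by move=> j _; rewrite -[X in measurable X]setTI; exact: mY.
Qed.

(* The horizon N lets the same lemmas serve a finite family of inputs, such as
   the entries of a vector, and an infinite sequence. *)
Variable N : nat.
Hypothesis indepY : forall k B, (k <= N)%N -> (forall j, measurable (B j)) ->
  P (\bigcap_(j in `I_k) Y j @^-1` B j) =
  (\prod_(j < k) fine (P (Y j @^-1` B j)))%:E.

(** For a cylinder A the claim is the product rule applied to the k first inputs
and to the k+1 first inputs; it extends to the generated sigma-algebra. *)
Lemma cylinders_independent k A C : (k < N)%N -> <<s cylinders k >> A ->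
  measurable C -> P (A `&` Y k @^-1` C) = P A * P (Y k @^-1` C).
Proof.
move=> kN kA mC.
have mYC : measurable (Y k @^-1` C).
  by rewrite -[X in measurable X]setTI; exact: mY.
apply: (independent_g_sigma (@cylindersI _ _ _ Y k)) kA => //.
- exact: cylindersT.
- exact: cylinders_measurable.
move=> _ [B mB ->].
pose B' j := if (j < k)%N then B j else C.
have mB' j : measurable (B' j) by rewrite /B'; case: ifP.
have -> : \bigcap_(j in `I_k) Y j @^-1` B j `&` Y k @^-1` C =
    \bigcap_(j in `I_k.+1) Y j @^-1` B' j.
  apply/seteqP; split => [x [Bx Cx] j /=|x Bx].
    rewrite /B'; case: (ltnP j k) => jk jk'; first exact: Bx.
    by rewrite (_ : j = k)//; apply/eqP; rewrite eqn_leq jk -ltnS jk'.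
  split => [j jk|]; first by have := Bx j (ltnW jk : `I_k.+1 j); rewrite /B'/= jk.
  by have := Bx k (ltnSn k); rewrite /B' /= ltnn.
rewrite !indepY// ?(ltnW kN)// big_ord_recr /= EFinM; congr (_ * _).
  by congr EFin; apply: eq_bigr => j _; rewrite /B' ltn_ord.
by rewrite fineK ?fin_num_measure// /B' ltnn.
Qed.

Context d2 (T2 : measurableType d2) (F : nat -> T2 * T1 -> T2).
Hypothesis mF : forall k, measurable_fun setT (F k).
Variables (S : nat -> T -> T2) (s0 : T2).
Hypotheses (S0 : forall x, S 0 x = s0)
  (SS : forall k x, S k.+1 x = F k (S k x, Y k x)).

(** Measurability of the state with respect to the history, rather than plain
measurability, is what makes it independent of the next input. *)
Lemma recursion_history k A : measurable A -> <<s cylinders k >> (S k @^-1` A).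
Proof.
suff H : measurable_fun (setT : set (g_sigma_algebraType (cylinders k))) (S k).
  by move=> mA; have := H measurableT A mA; rewrite setTI.
elim: k => [|k IHk].
  rewrite (_ : S 0 = cst s0); first exact: measurable_cst.
  exact/funext.
rewrite (_ : S k.+1 = F k \o (fun x => (S k x, Y k x))); last exact/funext.
apply: measurableT_comp => //.
apply: (@measurable_fun_pair _ _ _ (g_sigma_algebraType (cylinders k.+1))).
  move=> _ B mB; rewrite setTI.
  have := IHk measurableT B mB; rewrite setTI.
  by apply: sub_smallest2r; [exact: smallest_sigma_algebra|exact: cylindersS].
move=> _ B mB; rewrite setTI; apply: sub_sigma_algebra.
exact: cylinders_last.
Qed.

Lemma measurable_recursion k : measurable_fun setT (S k).
Proof.
move=> _ A mA; rewrite setTI.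
apply: (smallest_sub (@sigma_algebra_measurable _ T) (@cylinders_measurable k)).
exact: recursion_history.
Qed.

Lemma recursion_independent k A C : (k < N)%N -> measurable A -> measurable C ->
  P (S k @^-1` A `&` Y k @^-1` C) = P (S k @^-1` A) * P (Y k @^-1` C).
Proof.
by move=> kN mA mC; apply: cylinders_independent => //; exact: recursion_history.
Qed.

End history.

Section gaussian_vector.
Local Open Scope ereal_scope.
Context d (Omega : measurableType d) (R : realType) (P : probability Omega R).
Context (n : nat).
Implicit Types X : {RV P >-> 'cV[R]_n}.

Let mX X i : measurable_fun setT (fun omega => X omega i 0%R).
Proof.
have mE : measurable_fun setT (fun M : 'cV[R]_n => M i 0%R).
  exact: measurable_mx_entry.
exact: (measurableT_comp mE).
Qed.

(** Reduced to [normal_second_moment] by factoring out c, which requires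
treating c = 0 apart. *)
Lemma coord_second_moment X i (s c : R) : std_gaussian_vector X ->
  \int[P]_omega ((s + c * X omega i 0) ^+ 2)%R%:E = (s ^+ 2 + c ^+ 2)%R%:E.
Proof.
move=> [XN _]; have [->|c0] := eqVneq c 0%R.
  under eq_integral do rewrite mul0r addr0.
  by rewrite expr0n addr0 integral_cst//= probability_setT mule1.
have H : \int[P]_omega ((s / c + X omega i 0) ^+ 2)%R%:E = ((s / c) ^+ 2 + 1)%:E.
  rewrite -normal_second_moment.
  have mf : measurable_fun (setT : set (measurableTypeR R))
      (fun x => ((s / c + x) ^+ 2)%R%:E).
    by apply/measurable_EFinP; apply: measurable_funX; exact: measurable_funD.
  have mX' : measurable_fun setT
    ((fun omega => X omega i 0%R) : Omega -> measurableTypeR R) by exact: mX.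
  rewrite -(ge0_integral_law P mX' mf); last first.
    by move=> y; rewrite lee_fin sqr_ge0.
  by apply: eq_measure_integral => A mA _; exact: XN.
transitivity (\int[P]_omega ((c ^+ 2)%R%:E * ((s / c + X omega i 0) ^+ 2)%R%:E)).
  by apply: eq_integral => omega _; rewrite -EFinM; congr EFin; field.
rewrite ge0_integralZl//.
- by rewrite H -EFinM; congr EFin; field.
- by apply/measurable_EFinP; apply: measurable_funX; exact: measurable_funD.
- by move=> x _; rewrite lee_fin sqr_ge0.
- by rewrite lee_fin sqr_ge0.
Qed.

(* The entries indexed by natural numbers and padded with zeros, to fit the
   indexing of recursions. *)
Let Y X j omega : R := if insub j is Some i then X omega (i : 'I_n) 0%R else 0%R.

Let YE X (i : 'I_n) omega : Y X i omega = X omega i 0%R.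
Proof. by rewrite /Y valK. Qed.

Let mY X j : measurable_fun setT (Y X j).
Proof. by rewrite /Y; case: insubP => [i _ _|_]; [exact: mX|exact: measurable_cst]. Qed.

Let indepY X : std_gaussian_vector X ->
  forall k B, (k <= n)%N -> (forall j, measurable (B j)) ->
  P (\bigcap_(j in `I_k) Y X j @^-1` B j) =
  (\prod_(j < k) fine (P (Y X j @^-1` B j)))%:E.
Proof.
move=> [_ Xi] k B kn mB.
have := Xi [seq widen_ord kn i | i <- enum 'I_k]
  (fun i => (fun omega => X omega i 0%R) @^-1` B i).
rewrite map_inj_uniq ?enum_uniq; last by move=> i j /(congr1 val)/= /val_inj.
move=> /(_ isT).
rewrite big_map big_enum /=.
rewrite (_ : \bigcap_(_ in _) _ = \bigcap_(j in `I_k) Y X j @^-1` B j); last first.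
  apply/seteqP; split => omega Bo j /=.
    move=> jk; have -> : j = widen_ord kn (Ordinal jk) by [].
    rewrite YE; apply: (Bo (widen_ord kn (Ordinal jk))) => /=.
    by apply/mapP; exists (Ordinal jk); rewrite ?mem_enum.
  move=> /mapP[i _ ->] /=; have := Bo i (ltn_ord i).
  by rewrite /= -[nat_of_ord i]/(nat_of_ord (widen_ord kn i)) YE.
move=> ->.
  congr EFin; apply: eq_bigr => i _; congr (fine (P _)).
  by apply/funext => omega /=; rewrite -[nat_of_ord i]/(nat_of_ord (widen_ord kn i)) YE.
by move=> j _; exists (B j) => //; rewrite setTI.
Qed.

(** The partial sums form a recursion driven by the entries of X. Each new entry
is independent of the partial sum, so integrating it with the sum frozen adds
c_k^2 and produces no cross term. *)
Lemma linear_second_moment X (s : R) (c : 'I_n -> R) : std_gaussian_vector X ->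
  \int[P]_omega ((s + \sum_i c i * X omega i 0) ^+ 2)%R%:E =
  (s ^+ 2 + \sum_i c i ^+ 2)%R%:E.
Proof.
move=> gX.
pose c' j : R := if insub j is Some i then c i else 0%R.
have c'E (i : 'I_n) : c' i = c i by rewrite /c' valK.
pose S k omega := (s + \sum_(j < k) c' j * Y X j omega)%R.
pose F k (z : R * R) : R := (z.1 + c' k * z.2)%R.
have mF k : measurable_fun setT (F k).
  by apply: measurable_funD => //; apply: measurable_funM.
have S0 omega : S 0%N omega = s by rewrite /S big_ord0 addr0.
have SS k omega : S k.+1 omega = F k (S k omega, Y X k omega).
  by rewrite /S /F /= big_ord_recr addrA.
have mS := measurable_recursion (mY X) mF S0 SS.
have H k : (k <= n)%N -> \int[P]_omega (S k omega ^+ 2)%R%:E =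
    (s ^+ 2 + \sum_(j < k) c' j ^+ 2)%R%:E.
  elim: k => [_|k IHk kn].
    under eq_integral do rewrite S0.
    by rewrite big_ord0 addr0 integral_cst//= probability_setT mule1.
  under eq_integral do rewrite SS.
  rewrite (ge0_integral_independent (mS k) (mY X k) _
    (g := fun z => (F k z ^+ 2)%R%:E)); last 3 first.
  - move=> A B mA mB.
    exact: (recursion_independent (mY X) (indepY gX) mF S0 SS).
  - by apply/measurable_EFinP; apply: measurable_funX.
  - by move=> z; rewrite lee_fin sqr_ge0.
  transitivity (\int[P]_x ((S k x ^+ 2)%R%:E + (c' k ^+ 2)%R%:E)).
    apply: eq_integral => x _; rewrite -EFinD.
    rewrite -(coord_second_moment (Ordinal kn) _ _ gX); apply: eq_integral => y _.
    by rewrite /F /= -YE.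
  rewrite ge0_integralD//; last 3 first.
  - by move=> x _; rewrite lee_fin sqr_ge0.
  - by apply/measurable_EFinP; apply: measurable_funX.
  - by move=> x _; rewrite lee_fin sqr_ge0.
  by rewrite IHk 1?ltnW// integral_cst//= probability_setT mule1 -EFinD big_ord_recr/= addrA.
transitivity (\int[P]_omega (S n omega ^+ 2)%:E).
  apply: eq_integral => omega _; rewrite /S; congr (EFin ((_ + _) ^+ 2)%R).
  by apply: eq_bigr => i _; rewrite c'E YE.
rewrite H//; congr (EFin (_ + _)%R).
by apply: eq_bigr => i _; rewrite c'E.
Qed.

(** The entry i of Q^T X is a combination of the entries of X whose coefficients,
the column i of Q, have square sum 1. *)
Lemma orthogonal_second_moment (Q : 'M[R]_n) X i (s c : R) :
  Q^T *m Q = 1%:M -> std_gaussian_vector X ->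
  \int[P]_omega ((s + c * (Q^T *m X omega) i 0) ^+ 2)%R%:E = (s ^+ 2 + c ^+ 2)%R%:E.
Proof.
move=> QTQ gX.
transitivity (\int[P]_omega ((s + \sum_j (c * Q j i) * X omega j 0%R) ^+ 2)%R%:E).
  apply: eq_integral => omega _; congr (EFin ((_ + _) ^+ 2)%R).
  by rewrite mxE mulr_sumr; apply: eq_bigr => j _; rewrite mxE mulrA.
rewrite linear_second_moment//; congr (EFin (_ + _)%R).
have QQ : (\sum_j Q j i * Q j i = 1)%R.
  have := congr1 (fun M : 'M[R]_n => M i i) QTQ; rewrite !mxE eqxx /= mulr1n => QQ; rewrite -[RHS]QQ.
  by apply: eq_bigr => j _; rewrite mxE.
rewrite -[RHS]mulr1 -QQ mulr_sumr; apply: eq_bigr => j _.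
by rewrite exprMn expr2.
Qed.

End gaussian_vector.

(** * One step of the scheme in eigen-coordinates *)

Section eigen_step.
Context {R : realType} {n : nat}.
Variables (mu gamma alpha rho : R) (A Q : 'M[R]_n) (a : 'rV[R]_n) (b : 'cV[R]_n).
Hypotheses (mu0 : 0 < mu) (gamma0 : 0 < gamma) (alpha0 : 0 < alpha).
Hypotheses (diagA : orthogonal_diagonalization A Q a).
Hypothesis a0 : forall i, 0 < a 0 i.

Definition eigen_coord (u : 'cV[R]_n) (i : 'I_n) : R :=
  (Q^T *m (u - xstar A b)) i 0.

(** Equals r / (1 + tau) with r = 1 / (1 + lambda a); in this form without nested
fractions the dependence on alpha is visible. *)
Definition gain (a : R) : R := gamma / (gamma * (1 + tau mu gamma alpha) + alpha * a).

Local Notation t := (tau mu gamma alpha).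
Local Notation step := (scheme_step mu gamma alpha rho (quad A b)).
Implicit Types (s : 'cV[R]_n * 'cV[R]_n) (u : 'cV[R]_n).

(** The conditional mean of the next position coordinate given the state. *)
Definition drift (i : 'I_n) s : R :=
  gain (a 0 i) * (eigen_coord s.2 i + t * eigen_coord s.1 i).

Lemma tau_gt0 : 0 < t.
Proof. by rewrite /tau addr_gt0 ?invr_gt0 ?divr_gt0. Qed.

Let step_coord s u i :
  (\row_(j < 2) (if j == 0 then eigen_coord (step s u).1 i
                 else eigen_coord (step s u).2 i)) =
  coord_step mu gamma alpha (a 0 i)
    (\row_j (if j == 0 then eigen_coord s.1 i else eigen_coord s.2 i))
    ((Q^T *m noise mu gamma alpha rho u) i 0).
Proof.
case: s => x v.
exact: (eigen_recursion b diagA a0 rho (fun _ (_ : unit) => u) x v 0 tt i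
  mu0 gamma0 alpha0).
Qed.

Lemma eigen_coord_step1 s u i : eigen_coord (step s u).1 i =
  drift i s + gain (a 0 i) * (Num.sqrt alpha * rho) * (Q^T *m u) i 0.
Proof.
have := step_coord s u i.
have -> : (Q^T *m noise mu gamma alpha rho u) i 0 =
   Num.sqrt alpha * rho / (1 + t) * (Q^T *m u) i 0.
  by rewrite /noise -scalemxAr mxE.
move: ((Q^T *m u) i 0) => z /(congr1 (fun v : 'rV[R]_2 => v 0 0)).
rewrite /coord_step !mxE /= => ->.
have t1 : 1 + t != 0 by rewrite gt_eqF// addr_gt0// tau_gt0.
have ha : gamma * (1 + t) + alpha * a 0 i != 0.
  by rewrite gt_eqF// addr_gt0// mulr_gt0// addr_gt0// tau_gt0.
have hg : gamma != 0 by rewrite gt_eqF.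
rewrite /drift /gain /stepsize.
move: (eigen_coord _ _) (eigen_coord _ _) => e w.
field.
by rewrite ha t1 hg.
Qed.

Lemma eigen_coord_step2 s u i : eigen_coord (step s u).2 i =
  (alpha^-1 + 1) * eigen_coord (step s u).1 i - alpha^-1 * eigen_coord s.1 i.
Proof.
have := step_coord s u i; move: ((Q^T *m noise _ _ _ _ u) i 0) => z H.
have e1 := congr1 (fun v : 'rV[R]_2 => v 0 0) H.
have := congr1 (fun v : 'rV[R]_2 => v 0 1) H.
by move: e1; rewrite /coord_step !mxE /= => <- ->.
Qed.

Lemma eigen_coordK u : u = xstar A b + Q *m (\col_i eigen_coord u i).
Proof.
have -> : \col_i eigen_coord u i = Q^T *m (u - xstar A b).
  by apply/matrixP => i j; rewrite mxE ord1.
have QQT : Q *m Q^T = 1%:M by case: diagA => _ QTQ _; exact: mulmx1C.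
by rewrite mulmxA QQT mul1mx addrC subrK.
Qed.

Lemma sqnorm_eigen_coord u : sqnorm (u - xstar A b) = \sum_i eigen_coord u i ^+ 2.
Proof.
have QQT : Q *m Q^T = 1%:M by case: diagA => _ QTQ _; exact: mulmx1C.
have sE (v : 'cV[R]_n) : sqnorm v = (v^T *m v) 0 0.
  by rewrite mxE; apply: eq_bigr => i _; rewrite mxE expr2.
rewrite -[RHS]/(sqnorm (Q^T *m (u - xstar A b))) !sE trmx_mul trmxK.
by rewrite mulmxA -(mulmxA _ Q) QQT mulmx1.
Qed.

Lemma measurable_eigen_coord i : measurable_fun setT (eigen_coord^~ i).
Proof.
rewrite (_ : eigen_coord^~ i =
  (fun u => \sum_j Q j i * (u j 0 - xstar A b j 0))); last first.
  apply/funext => u; rewrite /eigen_coord mxE; apply: eq_bigr => j _.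
  by rewrite !mxE.
apply: measurable_sum => j; apply: measurable_funM => //.
by apply: measurable_funB => //; exact: measurable_mx_entry.
Qed.

Lemma measurable_drift i : measurable_fun setT (drift i).
Proof.
have m1 := measurableT_comp (measurable_eigen_coord i) (@measurable_fst _ _ 'cV[R]_n 'cV[R]_n).
have m2 := measurableT_comp (measurable_eigen_coord i) (@measurable_snd _ _ 'cV[R]_n 'cV[R]_n).
apply: measurable_funM => //; apply: measurable_funD => //.
exact: measurable_funM.
Qed.

(** The proximal map is defined by a choice of minimizer, so measurability is
obtained from the explicit formula for its eigen-coordinates. *)
Lemma measurable_step :
  measurable_fun setT (fun z : ('cV[R]_n * 'cV[R]_n) * 'cV[R]_n => step z.1 z.2).
Proof.
pose ez i (z : ('cV[R]_n * 'cV[R]_n) * 'cV[R]_n) := eigen_coord (step z.1 z.2).1 i.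
have mez i : measurable_fun setT (ez i).
  rewrite (_ : ez i = fun z => drift i z.1 +
    gain (a 0 i) * (Num.sqrt alpha * rho) * (Q^T *m z.2) i 0); last first.
    by apply/funext => z; exact: eigen_coord_step1.
  apply: measurable_funD.
    exact: (measurableT_comp (measurable_drift i)).
  apply: measurable_funM => //.
  have mQ : measurable_fun setT (fun u : 'cV[R]_n => (Q^T *m u) i 0).
    under eq_fun do rewrite mxE.
    apply: measurable_sum => j; apply: measurable_funM => //.
    exact: measurable_mx_entry.
  exact: (measurableT_comp mQ).
have m1 : measurable_fun setT
    (fun z : ('cV[R]_n * 'cV[R]_n) * 'cV[R]_n => (step z.1 z.2).1).
  apply: measurable_fun_mx => i j.
  rewrite (_ : (fun _ => _) = fun z => xstar A b i j + \sum_k Q i k * ez k z).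
    apply: measurable_funD => //; apply: measurable_sum => k.
    exact: measurable_funM.
  apply/funext => z; rewrite [(step z.1 z.2).1]eigen_coordK !mxE; congr (_ + _).
  by apply: eq_bigr => k _; rewrite mxE.
apply: measurable_fun_pair => //.
apply: measurable_fun_mx => i j.
have mij : measurable_fun setT (fun M : 'cV[R]_n => M i j).
  exact: measurable_mx_entry.
rewrite (_ : (fun _ => _) = fun z => (step z.1 z.2).1 i j +
    alpha^-1 * ((step z.1 z.2).1 i j - z.1.1 i j)); last first.
  by apply/funext => z; rewrite /scheme_step /= !mxE.
have mij1 := measurableT_comp mij m1.
apply: measurable_funD => //; apply: measurable_funM => //.
apply: measurable_funB => //; apply: (measurableT_comp mij).
exact: (measurableT_comp measurable_fst).
Qed.

End eigen_step.

(** * Conditional second moments of a step *)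

Section scalar_bounds.
Context {R : realType}.
Variables (mu gamma : R).
Hypotheses (mu0 : 0 < mu) (gamma0 : 0 < gamma).

(** The value of tau at alpha = 1, where it is largest among alpha >= 1. *)
Definition tau_max : R := 1 + mu / gamma.

(** With m the noiseless part of e' and v its variance, the second moment of a
step is at most 9 m^2 + 5 v + 2 e^2 / alpha^2: as 1 / alpha + 1 <= 2, the
coordinate w' contributes 2 (2 m)^2 + 2 e^2 / alpha^2 and 4 v. The three terms
below come from m^2 <= 2 (gamma / mu)^2 (1 + T^2) (e^2 + w^2) / alpha^2, from
v <= (gamma / mu)^2 rho^2 / alpha and from 2 e^2 / alpha^2. *)
Definition contraction_const : R :=
  18 * (gamma / mu) ^+ 2 * (1 + tau_max ^+ 2) + 5 * (gamma / mu) ^+ 2 + 2.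

Lemma contraction_const_gt0 : 0 < contraction_const.
Proof.
rewrite /contraction_const; have := sqr_ge0 (gamma / mu); have := sqr_ge0 tau_max.
by nra.
Qed.

Variables (alpha a : R).
Hypotheses (alpha1 : 1 <= alpha) (a_mu : mu <= a).

Let alpha0 : 0 < alpha. Proof. exact: lt_le_trans alpha1. Qed.

Lemma tau_le_max : tau mu gamma alpha <= tau_max.
Proof. by rewrite /tau /tau_max lerD2r invf_le1. Qed.

Lemma gain_gt0 : 0 < gain mu gamma alpha a.
Proof.
have a0 : 0 < a by exact: lt_le_trans a_mu.
by rewrite /gain divr_gt0// addr_gt0// mulr_gt0// addr_gt0// tau_gt0.
Qed.

(** Dropping the term gamma (1 + tau) of the denominator leaves
gamma / (alpha a), and a >= mu. *)
Lemma gain_le : gain mu gamma alpha a <= gamma / mu / alpha.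
Proof.
have -> : gamma / mu / alpha = gamma * (mu * alpha)^-1 by rewrite invfM mulrA.
rewrite /gain; apply: ler_wpM2l; first exact: ltW.
rewrite lef_pV2 ?posrE.
- rewrite -[leLHS]add0r lerD//.
    by rewrite mulr_ge0 ?ltW// addr_gt0// tau_gt0.
  by rewrite mulrC ler_wpM2l// ltW.
- have a0 : 0 < a by exact: lt_le_trans a_mu.
  by rewrite addr_gt0// mulr_gt0// addr_gt0// tau_gt0.
- by rewrite mulr_gt0.
Qed.

(** (w + tau e)^2 <= 2 (w^2 + T^2 e^2), and the gain is at most
gamma / (mu alpha). *)
Lemma drift_sqr_le (e w : R) :
  (gain mu gamma alpha a * (w + tau mu gamma alpha * e)) ^+ 2 <=
  2 * (gamma / mu) ^+ 2 * (1 + tau_max ^+ 2) / alpha ^+ 2 * (e ^+ 2 + w ^+ 2).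
Proof.
have t0 := ltW (tau_gt0 mu0 gamma0 alpha0); have t1 := tau_le_max.
have p0 := ltW gain_gt0; have p1 := gain_le.
set t := tau _ _ _ in t0 t1 *; set T := tau_max in t1 *.
set p := gain _ _ _ _ in p0 p1 *; set g := gamma / mu in p1 *.
have pp : p ^+ 2 <= g ^+ 2 / alpha ^+ 2.
  by rewrite -expr_div_n lerXn2r// nnegrE//; exact: le_trans p1.
have tT : t ^+ 2 <= T ^+ 2 by rewrite lerXn2r// nnegrE//; exact: le_trans t1.
have -> : 2 * g ^+ 2 * (1 + T ^+ 2) / alpha ^+ 2 * (e ^+ 2 + w ^+ 2) =
  g ^+ 2 / alpha ^+ 2 * (2 * (1 + T ^+ 2) * (e ^+ 2 + w ^+ 2)) by ring.
rewrite exprMn; apply: ler_pM => //; try exact: sqr_ge0.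
have te : t ^+ 2 * e ^+ 2 <= T ^+ 2 * e ^+ 2 by rewrite ler_wpM2r// sqr_ge0.
have h1 := sqr_ge0 (w - t * e); have h2 := sqr_ge0 e; have h3 := sqr_ge0 w.
have h4 : 0 <= T ^+ 2 * w ^+ 2 by rewrite mulr_ge0 ?sqr_ge0.
by clearbody T t; lra.
Qed.

(** The noise has variance of order alpha, damped by the square of a gain of
order 1 / alpha. *)
Lemma noise_var_le (rho : R) :
  gain mu gamma alpha a ^+ 2 * alpha * rho ^+ 2 <=
  (gamma / mu) ^+ 2 * rho ^+ 2 / alpha.
Proof.
have p0 := ltW gain_gt0; have p1 := gain_le.
have -> : (gamma / mu) ^+ 2 * rho ^+ 2 / alpha =
  (gamma / mu / alpha) ^+ 2 * alpha * rho ^+ 2.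
  by field; rewrite !gt_eqF.
rewrite ler_wpM2r ?sqr_ge0// ler_wpM2r ?(ltW alpha0)//.
by rewrite lerXn2r// nnegrE//; exact: le_trans p1.
Qed.

(** The mean of e'^2 + w'^2 from the state (e, w): m is the conditional mean of e'
and v its conditional variance, and w' is an affine function of e'. *)
Definition step_second_moment (rho e w : R) : R :=
  let m := gain mu gamma alpha a * (w + tau mu gamma alpha * e) in
  let v := gain mu gamma alpha a ^+ 2 * alpha * rho ^+ 2 in
  m ^+ 2 + v +
  (((alpha^-1 + 1) * m - alpha^-1 * e) ^+ 2 + (alpha^-1 + 1) ^+ 2 * v).

Lemma step_second_moment_le (rho e w : R) :
  step_second_moment rho e w <=
  contraction_const / alpha ^+ 2 * (e ^+ 2 + w ^+ 2) +
  contraction_const * rho ^+ 2 / alpha.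
Proof.
rewrite /step_second_moment.
have := drift_sqr_le e w; have := noise_var_le rho.
set m := gain _ _ _ _ * _; set v := _ * alpha * _.
have v0 : 0 <= v by rewrite mulr_ge0 ?sqr_ge0// mulr_ge0 ?sqr_ge0// ltW.
have q0 : 0 < alpha^-1 by rewrite invr_gt0.
have q1 : alpha^-1 <= 1 by rewrite invf_le1.
rewrite -exprVn /contraction_const.
set q := alpha^-1 in q0 q1 *; set g := (gamma / mu) ^+ 2; set T := 1 + _ ^+ 2.
have g0 : 0 <= g by exact: sqr_ge0.
have T0 : 0 <= T by rewrite /T addr_ge0 ?sqr_ge0.
move=> hv hm; clearbody m v q g T.
have h1 : ((q + 1) * m - q * e) ^+ 2 <= 8 * m ^+ 2 + 2 * (q ^+ 2 * e ^+ 2).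
  have := sqr_ge0 ((q + 1) * m + q * e).
  have : (q + 1) ^+ 2 * m ^+ 2 <= 4 * m ^+ 2.
    by rewrite ler_wpM2r ?sqr_ge0//; nra.
  by lra.
have h2 : (q + 1) ^+ 2 * v <= 4 * v by rewrite ler_wpM2r//; nra.
have e0 := sqr_ge0 e; have w0 := sqr_ge0 w; have r0 := sqr_ge0 rho.
set N := e ^+ 2 + w ^+ 2 in hm *; have N0 : 0 <= N by rewrite /N addr_ge0.
have q2 := sqr_ge0 q.
have h3 : q ^+ 2 * e ^+ 2 <= q ^+ 2 * N by rewrite ler_wpM2l// /N lerDl.
have h4 : 0 <= g * (q ^+ 2 * N) by exact: (mulr_ge0 g0 (mulr_ge0 q2 N0)).
have h6 : 0 <= rho ^+ 2 * q by exact: (mulr_ge0 r0 (ltW q0)).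
have h5 : 0 <= g * T * (rho ^+ 2 * q) by exact: (mulr_ge0 (mulr_ge0 g0 T0)).
clearbody N.
by lra.
Qed.

End scalar_bounds.

Section step_moments.
Context d (Omega : measurableType d) {R : realType} (P : probability Omega R) {n : nat}.
Variables (mu gamma alpha rho : R) (A Q : 'M[R]_n) (a : 'rV[R]_n) (b : 'cV[R]_n).
Hypotheses (mu0 : 0 < mu) (gamma0 : 0 < gamma) (alpha0 : 0 < alpha).
Hypotheses (diagA : orthogonal_diagonalization A Q a).
Hypothesis a0 : forall i, 0 < a 0 i.
Variable X : {RV P >-> 'cV[R]_n}.
Hypothesis gX : std_gaussian_vector X.
Local Notation step := (scheme_step mu gamma alpha rho (quad A b)).
Local Notation coord := (eigen_coord A Q b).

Let QTQ : Q^T *m Q = 1%:M. Proof. by case: diagA. Qed.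

Lemma integral_step1 s i :
  (\int[P]_omega (coord (step s (X omega)).1 i ^+ 2)%:E =
   (drift mu gamma alpha A Q a b i s ^+ 2 +
    gain mu gamma alpha (a 0 i) ^+ 2 * alpha * rho ^+ 2)%:E)%E.
Proof.
under eq_integral do rewrite (eigen_coord_step1 _ b mu0 gamma0 alpha0 diagA)//.
rewrite (orthogonal_second_moment _ _ _ QTQ gX); congr (EFin (_ + _)).
by rewrite !exprMn sqr_sqrtr ?ltW// mulrA.
Qed.

Let step2_coef i : R :=
  (alpha^-1 + 1) * (gain mu gamma alpha (a 0 i) * (Num.sqrt alpha * rho)).

Lemma integral_step2 s i :
  (\int[P]_omega (coord (step s (X omega)).2 i ^+ 2)%:E =
   (((alpha^-1 + 1) * drift mu gamma alpha A Q a b i s - alpha^-1 * coord s.1 i) ^+ 2 +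
    (alpha^-1 + 1) ^+ 2 * (gain mu gamma alpha (a 0 i) ^+ 2 * alpha * rho ^+ 2))%:E)%E.
Proof.
transitivity (\int[P]_omega ((((alpha^-1 + 1) * drift mu gamma alpha A Q a b i s -
   alpha^-1 * coord s.1 i) + step2_coef i * (Q^T *m X omega) i 0) ^+ 2)%:E)%E.
  apply: eq_integral => omega _.
  rewrite (eigen_coord_step2 rho b mu0 gamma0 alpha0 diagA)//.
  rewrite (eigen_coord_step1 rho b mu0 gamma0 alpha0 diagA)// /step2_coef.
  by congr (EFin (_ ^+ 2)); ring.
rewrite (orthogonal_second_moment _ _ _ QTQ gX); congr (EFin (_ + _)).
by rewrite /step2_coef !exprMn sqr_sqrtr ?(ltW alpha0)//; ring.
Qed.

Let m_step s (proj : 'cV[R]_n * 'cV[R]_n -> 'cV[R]_n) i : measurable_fun setT proj ->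
  measurable_fun setT (fun omega => coord (proj (step s (X omega))) i).
Proof.
move=> mp; apply: (measurableT_comp (measurable_eigen_coord A Q b i)).
apply: (measurableT_comp mp).
have ms := @measurable_step _ _ _ _ _ rho _ _ _ b mu0 gamma0 alpha0 diagA a0.
exact: (measurableT_comp (measurable_fun_pair2 s ms)).
Qed.

Lemma integral_step s i :
  (\int[P]_omega (coord (step s (X omega)).1 i ^+ 2 +
                  coord (step s (X omega)).2 i ^+ 2)%:E =
   (step_second_moment mu gamma alpha (a 0 i) rho (coord s.1 i) (coord s.2 i))%:E)%E.
Proof.
under eq_integral do rewrite EFinD.
rewrite ge0_integralD//.
- by rewrite integral_step1 integral_step2.
- by move=> x _; rewrite lee_fin sqr_ge0.
- by apply/measurable_EFinP; apply: measurable_funX; apply: (m_step s i measurable_fst).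
- by move=> x _; rewrite lee_fin sqr_ge0.
- by apply/measurable_EFinP; apply: measurable_funX; apply: (m_step s i measurable_snd).
Qed.

End step_moments.

(** * Conditional expectation by freezing *)

Section conditional_expectation.
Local Open Scope ereal_scope.
Context d (Omega : measurableType d) (R : realType) (P : probability Omega R).
Context d' (T : measurableType d') (Y : Omega -> T).
Hypothesis mY : measurable_fun setT Y.

Let preimage_measurable B : g_sigma_algebra_preimage Y B -> measurable B.
Proof. by move=> [C mC <-]; exact: mY. Qed.

(** Conditional expectations are unique up to null sets, so it suffices to bound
one version. The set B on which another version Z' exceeds Z is itself an event
of the conditioning sigma-algebra, so Z and Z' have the same integral over it,
and Z' - Z > 0 on B forces B to be negligible. *)
Lemma cond_expectation_le_version (X W Z : Omega -> R) :
  is_cond_expectation P Y X Z -> (forall omega, Z omega <= W omega)%R ->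
  cond_expectation_le P Y X W.
Proof.
move=> XZ ZW; split; first by exists Z.
case: XZ => _ Zi mZ ZX Z' [_ Z'i mZ' Z'X].
pose B := [set omega | 0 < Z' omega - Z omega]%R.
have YB : g_sigma_algebra_preimage Y B.
  have mf (f : Omega -> R) : (forall U, measurable U ->
      g_sigma_algebra_preimage Y (f @^-1` U)) ->
      measurable_fun (setT : set (g_sigma_algebra_preimageType Y)) f.
    by move=> fY _ U mU; rewrite setTI; exact: fY.
  have := measurable_funB (mf _ mZ') (mf _ mZ) measurableT
    (measurable_itv (`]0%R, +oo[)).
  rewrite setTI (_ : _ @^-1` _ = B)//.
  by apply/seteqP; split => omega /=; rewrite in_itv/= andbT.
have mB := preimage_measurable YB.
have ZB : P.-integrable B (EFin \o Z) by exact: integrableS Zi.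
have Z'B : P.-integrable B (EFin \o Z') by exact: integrableS Z'i.
have : \int[P]_(omega in B) `|(Z' omega - Z omega)%:E| = 0.
  transitivity (\int[P]_(omega in B) ((EFin \o Z') omega - (EFin \o Z) omega)).
    apply: eq_integral => omega; rewrite inE => Bo.
    by rewrite gee0_abs ?EFinB// lee_fin ltW.
  rewrite integralB// /= Z'X// ZX// subee// -ZX//.
  by apply: integrable_fin_num.
have mD : measurable_fun B (fun omega => (Z' omega - Z omega)%:E).
  have [/integrableP[m1 _] /integrableP[m2 _]] := (ZB, Z'B).
  by apply/measurable_EFinP; apply: measurable_funB; exact/measurable_EFinP.
move=> /(ae_eq_integral_abs P mB mD).
apply: filterS => omega /= H; apply: le_trans (ZW _).
rewrite leNgt; apply/negP => ZZ'.
have Bo : B omega by rewrite /B /= subr_gt0.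
by have [] := H Bo; move: Bo; rewrite /B /= lt_neqAle => /andP[/eqP + _] => /nesym.
Qed.

Context d1 d2 (T1 : measurableType d1) (T2 : measurableType d2).
Variables (S : Omega -> T2) (U : Omega -> T1).
Hypotheses (mS : measurable_fun setT S) (mU : measurable_fun setT U).
Hypothesis SU : forall A B, measurable A -> measurable B ->
  P (S @^-1` A `&` U @^-1` B) = P (S @^-1` A) * P (U @^-1` B).
Variables (y : T2 -> T) (h : T -> R) (G : T2 * T1 -> R).
Hypotheses (my : measurable_fun setT y) (mh : measurable_fun setT h).
Hypotheses (mG : measurable_fun setT G) (G0 : forall z, (0 <= G z)%R).
Hypothesis YS : forall omega, Y omega = y (S omega).
Hypothesis GE : forall s, \int[P]_omega (G (s, U omega))%:E = (h (y s))%:E.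

(** The event depends on S only, so its indicator can be moved inside the product
formula for the independent pair (S, U); integrating over U first gives h. *)
Lemma freezing_integral B : measurable B ->
  \int[P]_(omega in Y @^-1` B) (G (S omega, U omega))%:E =
  \int[P]_(omega in Y @^-1` B) (h (Y omega))%:E.
Proof.
move=> mB; rewrite !(integral_mkcond (Y @^-1` B)).
have mBy : measurable_fun setT (fun s => \1_B (y s) : R).
  exact: (measurableT_comp (measurable_indic mB)).
transitivity (\int[P]_omega ((\1_B (y (S omega)) * G (S omega, U omega))%R%:E)).
  apply: eq_integral => omega _; rewrite patchE indicE -YS.
  by rewrite (_ : (omega \in _) = (Y omega \in B)) ?mem_preimage//; case: ifP; rewrite ?mul1r ?mul0r.
rewrite (ge0_integral_independent mS mU SU
  (g := fun z => (\1_B (y z.1) * G z)%R%:E)); last 2 first.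
- apply/measurable_EFinP; apply: measurable_funM => //.
  exact: (measurableT_comp mBy).
- by move=> z; rewrite lee_fin mulr_ge0.
apply: eq_integral => omega _; rewrite patchE.
transitivity ((\1_B (y (S omega)))%:E * \int[P]_x (G (S omega, U x))%:E).
  rewrite -ge0_integralZl//.
  - apply/measurable_EFinP; apply: (measurableT_comp mG).
    exact: measurable_fun_pair.
  - by move=> x _; rewrite lee_fin.
rewrite GE indicE -YS (_ : (omega \in _) = (Y omega \in B)) ?mem_preimage//.
by case: ifP; rewrite ?mul1e ?mul0e.
Qed.

(** Here Y is the observed part of the state S. Freezing S gives a function of S,
which is a version of the conditional expectation given Y when it depends on S
through Y only. *)
Lemma freezing_cond_expectation : P.-integrable setT (fun omega => (h (Y omega))%:E) ->
  is_cond_expectation P Y (fun omega => G (S omega, U omega)) (fun omega => h (Y omega)).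
Proof.
move=> hi; split => //.
- apply/integrableP; split.
    apply/measurable_EFinP; apply: (measurableT_comp mG).
    exact: measurable_fun_pair.
  rewrite (eq_integral (fun omega => (G (S omega, U omega))%:E)); last first.
    by move=> omega _; rewrite /= ger0_norm.
  have := freezing_integral measurableT; rewrite preimage_setT => ->.
  by rewrite ltey_eq (integrable_fin_num _ hi).
- move=> V mV; exists (h @^-1` V); last by rewrite setTI.
  by rewrite -[X in measurable X]setTI; exact: mh.
- by move=> _ [B mB <-]; rewrite setTI freezing_integral.
Qed.

End conditional_expectation.

(** * Moments along the scheme *)

Lemma iid_cylinder d (Omega : measurableType d) (R : realType)
    (P : probability Omega R) n (eta : nat -> {RV P >-> 'cV[R]_n}) :
  iid_std_gaussian eta -> forall k (B : nat -> set 'cV[R]_n),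
  (forall j, measurable (B j)) ->
  P (\bigcap_(j in `I_k) eta j @^-1` B j) =
  (\prod_(j < k) fine (P (eta j @^-1` B j)))%:E.
Proof.
move=> [_ eta_indep] k B mB.
have := eta_indep (iota 0 k) (fun j => eta j @^-1` B j) (iota_uniq _ _).
rewrite (_ : \bigcap_(j in [set` iota 0 k]) _ = \bigcap_(j in `I_k) eta j @^-1` B j); last first.
  by apply/seteqP; split => omega H j /= jk; apply: H; move: jk; rewrite /= mem_iota.
move=> ->.
  by rewrite -(big_mkord xpredT (fun j => fine (P (eta j @^-1` B j)))) /index_iota subn0.
by move=> j _; exists (B j) => //; rewrite setTI.
Qed.

Section scheme_moments.
Context d (Omega : measurableType d) (R : realType) (P : probability Omega R).
Context (n : nat) (eta : nat -> {RV P >-> 'cV[R]_n}).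
Variables (mu gamma alpha rho : R) (A Q : 'M[R]_n) (a : 'rV[R]_n) (b : 'cV[R]_n).
Variables (x0 v0 : 'cV[R]_n).
Hypotheses (mu0 : 0 < mu) (gamma0 : 0 < gamma) (alpha1 : 1 <= alpha).
Hypotheses (diagA : orthogonal_diagonalization A Q a).
Hypothesis a_mu : forall i, mu <= a 0 i.
Hypothesis eta_iid : iid_std_gaussian eta.

Let alpha0 : 0 < alpha. Proof. exact: lt_le_trans alpha1. Qed.
Let a0 i : 0 < a 0 i. Proof. exact: lt_le_trans (a_mu i). Qed.

Local Notation state := ('cV[R]_n * 'cV[R]_n)%type.
Local Notation step := (scheme_step mu gamma alpha rho (quad A b)).
Local Notation coord := (eigen_coord A Q b).
Local Notation S := (quad_scheme mu gamma alpha rho A b eta x0 v0).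
Local Notation K := (contraction_const mu gamma).
Local Notation moment i := (step_second_moment mu gamma alpha (a 0 i) rho).

Let F (k : nat) (z : state * 'cV[R]_n) := step z.1 z.2.
Let mF k : measurable_fun setT (F k).
Proof. exact: (@measurable_step _ _ _ _ _ rho _ _ _ b mu0 gamma0 alpha0 diagA a0). Qed.

Let meta k : measurable_fun setT (eta k). Proof. exact: measurable_funPT. Qed.

Let S0 omega : S 0 omega = (x0, v0). Proof. by []. Qed.
Let SS k omega : S k.+1 omega = F k (S k omega, eta k omega). Proof. by []. Qed.

Lemma measurable_scheme k : measurable_fun setT (S k).
Proof. exact: (measurable_recursion meta mF S0 SS). Qed.

Lemma scheme_independent k B C : measurable B -> measurable C ->
  (P (S k @^-1` B `&` eta k @^-1` C) = P (S k @^-1` B) * P (eta k @^-1` C))%E.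
Proof.
apply: (@recursion_independent _ _ _ P _ _ (fun k => eta k) meta k.+1 _ _ _ F mF _ (x0, v0)) => //.
by move=> j D _ mD; exact: iid_cylinder.
Qed.

Definition coord_energy (i : 'I_n) (s : state) : R := coord s.1 i ^+ 2 + coord s.2 i ^+ 2.

Lemma coord_energy_ge0 i s : 0 <= coord_energy i s.
Proof. by rewrite /coord_energy addr_ge0 ?sqr_ge0. Qed.

Let mcoord1 i : measurable_fun setT (fun s : state => coord s.1 i).
Proof. exact: (measurableT_comp (measurable_eigen_coord A Q b i) measurable_fst). Qed.

Let mcoord2 i : measurable_fun setT (fun s : state => coord s.2 i).
Proof. exact: (measurableT_comp (measurable_eigen_coord A Q b i) measurable_snd). Qed.

Lemma measurable_coord_energy i : measurable_fun setT (coord_energy i).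
Proof. by apply: measurable_funD; exact: measurable_funX. Qed.

Lemma measurable_step_second_moment i :
  measurable_fun setT (fun p : R * R => moment i p.1 p.2).
Proof.
rewrite /step_second_moment.
have m1 : measurable_fun setT (fun p : R * R =>
    gain mu gamma alpha (a 0 i) * (p.2 + tau mu gamma alpha * p.1)).
  by apply: measurable_funM => //; apply: measurable_funD => //; apply: measurable_funM.
apply: measurable_funD; first by apply: measurable_funD => //; exact: measurable_funX.
apply: measurable_funD => //; apply: measurable_funX; apply: measurable_funB.
  exact: measurable_funM.
exact: measurable_funM.
Qed.

(* The coordinate energy after a step, as a function of the state and the noise. *)
Let energy i (z : state * 'cV[R]_n) := coord_energy i (step z.1 z.2).

Let menergy i : measurable_fun setT (energy i).
Proof. exact: (measurableT_comp (measurable_coord_energy i) (mF 0)). Qed.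

Let energy_ge0 i z : 0 <= energy i z. Proof. exact: coord_energy_ge0. Qed.

Let integral_energy i s k : (\int[P]_omega (energy i (s, eta k omega))%:E =
  (moment i (coord s.1 i) (coord s.2 i))%:E)%E.
Proof.
exact: (integral_step rho b mu0 gamma0 alpha0 diagA a0 (eta_iid.1 k)).
Qed.

Let moment_ge0 i e w : 0 <= moment i e w.
Proof.
rewrite /step_second_moment; have q0 := ltW alpha0.
have v0' : 0 <= gain mu gamma alpha (a 0 i) ^+ 2 * alpha * rho ^+ 2.
  by rewrite mulr_ge0 ?sqr_ge0// mulr_ge0 ?sqr_ge0.
by rewrite !addr_ge0 ?sqr_ge0// mulr_ge0 ?sqr_ge0.
Qed.

Let moment_le i e w : moment i e w <=
  K / alpha ^+ 2 * (e ^+ 2 + w ^+ 2) + K * rho ^+ 2 / alpha.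
Proof. exact: step_second_moment_le. Qed.

Let mmoment i k : measurable_fun setT
  (fun omega => moment i (coord (S k omega).1 i) (coord (S k omega).2 i)).
Proof.
have mS := measurable_scheme k.
have mp : measurable_fun setT
    (fun omega => (coord (S k omega).1 i, coord (S k omega).2 i)).
  apply: measurable_fun_pair.
    exact: (measurableT_comp (mcoord1 i) mS).
  exact: (measurableT_comp (mcoord2 i) mS).
exact: (measurableT_comp (measurable_step_second_moment i) mp).
Qed.

(** By induction on k: the mean energy after a step is at most an affine function
of the mean energy before it. *)
Lemma integrable_coord_energy k i :
  P.-integrable setT (fun omega => (coord_energy i (S k omega))%:E).
Proof.
elim: k => [|k IHk].
  by apply: (@finite_measure_integrable_cst _ _ _ P setT (coord_energy i (x0, v0))).
apply/integrableP; split.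
  apply/measurable_EFinP; apply: (measurableT_comp (measurable_coord_energy i)).
  exact: measurable_scheme.
rewrite (eq_integral (fun omega => (energy i (S k omega, eta k omega))%:E)); last first.
  by move=> omega _; rewrite /= ger0_norm ?coord_energy_ge0.
rewrite (ge0_integral_independent (measurable_scheme k) (meta k)
  (@scheme_independent k) (g := fun z => (energy i z)%:E)); last 2 first.
- exact/measurable_EFinP.
- by move=> z; rewrite lee_fin.
under eq_integral do rewrite integral_energy.
have := integrable_EFinD (integrable_EFinZ (K / alpha ^+ 2) IHk)
  (finite_measure_integrable_cst P (K * rho ^+ 2 / alpha) measurableT).
move=> /integrableP[mg]; apply: le_lt_trans; apply: ge0_le_integral => //.
- by move=> omega _; rewrite lee_fin.
- exact/measurable_EFinP.
- exact: measurableT_comp.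
- by move=> omega _ /=; rewrite lee_fin (le_trans _ (ler_norm _)).
Qed.

Lemma integrable_moment k i : P.-integrable setT
  (fun omega => (moment i (coord (S k omega).1 i) (coord (S k omega).2 i))%:E).
Proof.
have := integrable_EFinD (integrable_EFinZ (K / alpha ^+ 2) (integrable_coord_energy k i))
  (finite_measure_integrable_cst P (K * rho ^+ 2 / alpha) measurableT).
apply: le_integrable => //; first exact/measurable_EFinP.
move=> omega _ /=; rewrite lee_fin ger0_norm// (le_trans _ (ler_norm _))//.
Qed.

Local Notation e := (ecoord mu gamma alpha rho A Q b eta x0 v0).
Local Notation w := (wcoord mu gamma alpha rho A Q b eta x0 v0).

(** The mean of the new energy of coordinate i given the full state depends only
on the coordinate i of the state, so it is also the conditional expectation
given that coordinate alone. *)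
Lemma coord_cond_expectation k (i : 'I_n) :
  cond_expectation_le P (fun omega => (e k omega i 0, w k omega i 0))
    (fun omega => e k.+1 omega i 0 ^+ 2 + w k.+1 omega i 0 ^+ 2)
    (fun omega => K / alpha ^+ 2 * (e k omega i 0 ^+ 2 + w k omega i 0 ^+ 2) +
                  K * rho ^+ 2 / alpha).
Proof.
pose Y omega := (e k omega i 0, w k omega i 0).
have my : measurable_fun setT (fun s : state => (coord s.1 i, coord s.2 i)).
  exact: measurable_fun_pair.
have mY : measurable_fun setT Y by exact: (measurableT_comp my (measurable_scheme k)).
apply: (cond_expectation_le_version mY
  (Z := fun omega => moment i (Y omega).1 (Y omega).2)) => //.
change (is_cond_expectation P Y (fun omega => energy i (S k omega, eta k omega))
  (fun omega => (fun p : R * R => moment i p.1 p.2) (Y omega))).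
apply: (freezing_cond_expectation (measurable_scheme k) (meta k)
  (@scheme_independent k) my (measurable_step_second_moment i) (menergy i)) => //.
exact: integrable_moment.
Qed.

Lemma state_cond_expectation k :
  is_cond_expectation P (fun omega => (e k omega, w k omega))
    (fun omega => sqnorm (e k.+1 omega) + sqnorm (w k.+1 omega))
    (fun omega => \sum_i moment i (e k omega i 0) (w k omega i 0)).
Proof.
pose Y omega := (e k omega, w k omega).
pose y (s : state) : state := (Q^T *m (s.1 - xstar A b), Q^T *m (s.2 - xstar A b)).
have my : measurable_fun setT y.
  apply: measurable_fun_pair; apply: measurable_fun_mx => i j; rewrite (ord1 j).
    exact: mcoord1.
  exact: mcoord2.
have mY : measurable_fun setT Y by exact: (measurableT_comp my (measurable_scheme k)).
pose h (p : state) := \sum_i moment i (p.1 i 0) (p.2 i 0).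
have mh : measurable_fun setT h.
  apply: measurable_sum => i.
  have mi : measurable_fun setT (fun u : 'cV[R]_n => u i 0) by exact: measurable_mx_entry.
  have mp : measurable_fun setT (fun p : state => (p.1 i 0, p.2 i 0)).
    by apply: measurable_fun_pair; exact: (measurableT_comp mi).
  exact: (measurableT_comp (measurable_step_second_moment i) mp).
pose G z := \sum_i energy i z.
have mG : measurable_fun setT G by exact: measurable_sum.
have -> : (fun omega => sqnorm (e k.+1 omega) + sqnorm (w k.+1 omega)) =
    (fun omega => G (S k omega, eta k omega)).
  by apply/funext => omega; rewrite /sqnorm -big_split.
apply: (freezing_cond_expectation (measurable_scheme k) (meta k)
  (@scheme_independent k) my mh mG) => //.
- by move=> z; apply: sumr_ge0 => i _.
- move=> s; rewrite /G; under eq_integral do rewrite -sumEFin.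
  rewrite ge0_integral_sum//.
  + by rewrite -sumEFin; apply: eq_bigr => i _; rewrite integral_energy.
  + move=> i; apply/measurable_EFinP; apply: (measurableT_comp (menergy i)).
    exact: measurable_fun_pair.
  + by move=> i omega _; rewrite lee_fin.
- rewrite /h; under eq_fun do rewrite -sumEFin.
  by apply: integrable_sum => // i _; exact: integrable_moment.
Qed.

Let sum_moment_le (u v : 'cV[R]_n) :
  \sum_i moment i (u i 0) (v i 0) <=
  K / alpha ^+ 2 * (sqnorm u + sqnorm v) + K * (n%:R * rho ^+ 2) / alpha.
Proof.
apply: (@le_trans _ _ (\sum_i (K / alpha ^+ 2 * (u i 0 ^+ 2 + v i 0 ^+ 2) + K * rho ^+ 2 / alpha))).
  by apply: ler_sum => i _.
rewrite big_split /= -mulr_sumr big_split /= sumr_const card_ord lerD2l.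
by rewrite -mulr_natl; lra.
Qed.

Lemma state_cond_expectation_le k :
  cond_expectation_le P (fun omega => (e k omega, w k omega))
    (fun omega => sqnorm (e k.+1 omega) + sqnorm (w k.+1 omega))
    (fun omega => K / alpha ^+ 2 * (sqnorm (e k omega) + sqnorm (w k omega)) +
                  K * (n%:R * rho ^+ 2) / alpha).
Proof.
apply: (cond_expectation_le_version _ (state_cond_expectation k)) => //.
apply: measurable_fun_pair; apply: measurable_fun_mx => i j; rewrite (ord1 j).
  exact: (measurableT_comp (mcoord1 i) (measurable_scheme k)).
exact: (measurableT_comp (mcoord2 i) (measurable_scheme k)).
Qed.

Local Notation xs := (xstar A b).

Lemma integrable_position k : P.-integrable setT
  (fun omega => (sqnorm ((S k omega).1 - xs))%:E).
Proof.
have m : P.-integrable setT (fun omega => (\sum_i coord_energy i (S k omega))%:E).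
  under eq_fun do rewrite -sumEFin.
  by apply: integrable_sum => // i _; exact: integrable_coord_energy.
apply: le_integrable m => //.
  apply/measurable_EFinP; under eq_fun do rewrite (sqnorm_eigen_coord b diagA).
  apply: measurable_sum => i; apply: measurable_funX.
  exact: (measurableT_comp (mcoord1 i) (measurable_scheme k)).
move=> omega _ /=; rewrite lee_fin !ger0_norm.
- rewrite (sqnorm_eigen_coord b diagA); apply: ler_sum => i _.
  by rewrite /coord_energy lerDl sqr_ge0.
- by apply: sumr_ge0 => i _; exact: coord_energy_ge0.
- by apply: sumr_ge0 => i _; exact: sqr_ge0.
Qed.

(** After at least one step, w is a combination of the last two positions. This
is why the Lyapunov recursion starts at time 1: the initial v0 is arbitrary. *)
Lemma wcoord_sqnorm_le k omega :
  sqnorm (w k.+1 omega) <= 8 * sqnorm ((S k.+1 omega).1 - xs) +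
                           2 / alpha ^+ 2 * sqnorm ((S k omega).1 - xs).
Proof.
rewrite !(sqnorm_eigen_coord b diagA) !mulr_sumr -big_split /=.
apply: ler_sum => i _.
have -> : w k.+1 omega i 0 = (alpha^-1 + 1) * coord (S k.+1 omega).1 i -
    alpha^-1 * coord (S k omega).1 i.
  exact: (eigen_coord_step2 rho b mu0 gamma0 alpha0 diagA).
rewrite -exprVn.
have q0 : 0 < alpha^-1 by rewrite invr_gt0.
have q1 : alpha^-1 <= 1 by rewrite invf_le1.
move: (coord _ _) (coord _ _) (alpha^-1) q0 q1 => y x q q0 q1.
have h : (q + 1) ^+ 2 * x ^+ 2 <= 4 * x ^+ 2 by rewrite ler_wpM2r ?sqr_ge0//; nra.
by have := sqr_ge0 ((q + 1) * x + q * y); lra.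
Qed.

Definition lyapunov (theta : R) (k : nat) : \bar R :=
  ('E_P[fun omega => sqnorm ((S k omega).1 - xs)] +
   theta%:E * 'E_P[fun omega => sqnorm ((S k.-1 omega).1 - xs)])%E.

(** With m_k the mean of |x_k - xstar|^2, the contraction and [wcoord_sqnorm_le]
give m_(k+2) <= (K / alpha^2) (9 m_(k+1) + 2 m_k / alpha^2) + noise, the factor
9 being 1 for e and 8 for w. Adding m_(k+1) / alpha to both sides and using
alpha >= 1 yields the rate (9 K + 1) / alpha. *)
Lemma lyapunov_recursion k : (1 <= k)%N ->
  (lyapunov alpha^-1 k.+1 <= ((9 * K + 1) / alpha)%:E * lyapunov alpha^-1 k +
                             (K * (n%:R * rho ^+ 2) / alpha)%:E)%E.
Proof.
case: k => // k _.
pose m k := fine (\int[P]_omega (sqnorm ((S k omega).1 - xs))%:E)%E.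
have EV j : ('E_P[fun omega => sqnorm ((S j omega).1 - xs)] = (m j)%:E)%E.
  by rewrite unlock /m fineK// (integrable_fin_num _ (integrable_position j)).
have m0 j : 0 <= m j.
  rewrite /m fine_ge0// integral_ge0// => omega _.
  by rewrite lee_fin; apply: sumr_ge0 => i _; exact: sqr_ge0.
have K0 : 0 < K by exact: contraction_const_gt0.
set sigma2 := n%:R * rho ^+ 2.
pose c1 := K / alpha ^+ 2 * 9; pose c2 := K / alpha ^+ 2 * (2 / alpha ^+ 2).
pose c := K * sigma2 / alpha.
(* The conditional bound, integrated over the whole space. *)
have key : m k.+2 <= c1 * m k.+1 + c2 * m k + c.
  have i1 := integrable_EFinZ c1 (integrable_position k.+1).
  have i2 := integrable_EFinZ c2 (integrable_position k).
  have i3 := finite_measure_integrable_cst P c measurableT.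
  have i12 := integrable_EFinD i1 i2.
  have i := integrable_EFinD i12 i3.
  have [Xi Zi _ ZX] := state_cond_expectation k.+1.
  have {}ZX := ZX setT (ex_intro2 _ _ setT measurableT (setTI _)).
  rewrite -lee_fin -EV unlock.
  apply: (@le_trans _ _ (\int[P]_omega (sqnorm (e k.+2 omega) + sqnorm (w k.+2 omega))%:E)%E).
    apply: ge0_le_integral => //.
    - by move=> omega _; rewrite lee_fin; apply: sumr_ge0 => i' _; exact: sqr_ge0.
    - by have /integrableP[] := integrable_position k.+2.
    - by have /integrableP[] := Xi.
    - move=> omega _; rewrite lee_fin (sqnorm_eigen_coord b diagA) lerDl.
      by apply: sumr_ge0 => i' _; exact: sqr_ge0.
  rewrite -ZX !EFinD (EFinM c1) (EFinM c2) /m !fineK ?(integrable_fin_num _ (integrable_position _))//.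
  rewrite -!integralZl ?integrable_position//.
  have -> : (c%:E = \int[P]_omega c%:E)%E.
    by rewrite integral_cst//= probability_setT mule1.
  rewrite -integralD// -integralD//.
  apply: ge0_le_integral => //.
  - by move=> omega _; rewrite lee_fin; apply: sumr_ge0 => i' _; exact: moment_ge0.
  - by have /integrableP[] := Zi.
  - by have /integrableP[] := i.
  - move=> omega _; rewrite -!EFinM -!EFinD lee_fin.
    apply: le_trans (sum_moment_le _ _) _.
    rewrite -/sigma2 lerD2r /c1 /c2 -!mulrA -!mulrDr mulrA [leRHS]mulrA ler_wpM2l//.
      by rewrite divr_ge0 ?sqr_ge0// ltW.
    have := wcoord_sqnorm_le k omega.
    have -> : sqnorm (e k.+1 omega) = sqnorm ((S k.+1 omega).1 - xs).
      by rewrite (sqnorm_eigen_coord b diagA).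
    by lra.
have VE j : lyapunov alpha^-1 j = (m j + alpha^-1 * m j.-1)%:E.
  by rewrite /lyapunov (EV j) (EV j.-1) EFinD EFinM.
rewrite (VE k.+2) (VE k.+1) -EFinM -EFinD lee_fin -/sigma2 -/c !succnK.
have q0 : 0 < alpha^-1 by rewrite invr_gt0.
have q1 : alpha^-1 <= 1 by rewrite invf_le1.
move: key; rewrite /c1 /c2 -exprVn.
have := m0 k.+1; have := m0 k.
move: (m k.+2) (m k.+1) (m k) (alpha^-1) q0 q1 => x y z q q0 q1 z0 y0 key.
have qq : q ^+ 2 <= q by rewrite expr2 ler_piMl// ltW.
have h1 : K * q ^+ 2 * y <= K * q * y.
  by rewrite ler_wpM2r// ler_pM2l.
have h2 : K * q ^+ 2 * (q ^+ 2 * z) <= K * q * (q * z).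
  apply: ler_pM.
  - by apply: mulr_ge0; [exact: ltW|exact: sqr_ge0].
  - by apply: mulr_ge0 => //; exact: sqr_ge0.
  - by rewrite ler_pM2l.
  - exact: ler_wpM2r.
have h4 : 0 <= q * (q * z) by rewrite mulr_ge0 ?mulr_ge0 ?(ltW q0).
have h3 : 0 <= K * (q * (q * z)) by rewrite mulr_ge0 ?(ltW K0).
by lra.
Qed.

End scheme_moments.

(** * The space of noise sequences *)

Section same_law.
Local Open Scope ereal_scope.
Context d (Omega : measurableType d) (R : realType) (P : probability Omega R).
Context (n : nat).

(* The pi-system on which independence of the entries determines the law. *)
Let boxes : set (set 'cV[R]_n) :=
  [set A | exists2 B : 'I_n -> set R, (forall i, measurable (B i)) &
     A = \bigcap_(i in setT) (fun u : 'cV[R]_n => u i 0%R) @^-1` B i].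

Let boxesI : setI_closed boxes.
Proof.
move=> _ _ [B mB ->] [C mC ->]; exists (fun j => B j `&` C j).
  by move=> j; exact: measurableI.
by rewrite -bigcapI; apply: eq_bigcapr => j _; rewrite preimage_setI.
Qed.

Let boxesT : boxes setT.
Proof. by exists (fun=> setT) => //; apply/esym/seteqP; split. Qed.

Let measurable_boxes : @measurable _ 'cV[R]_n = <<s boxes >>.
Proof.
apply/seteqP; split.
  apply: smallest_sub; first exact: smallest_sigma_algebra.
  move=> _ [[i j] _ [C mC <-]] /=; rewrite setTI; apply: sub_sigma_algebra.
  exists (fun k => if k == i then C else setT).
    by move=> k; case: ifP.
  apply/seteqP; split => u /=.
    by rewrite (ord1 j) => Cu k _ /=; case: ifP => // /eqP ->.
  by move=> /(_ i I) /=; rewrite eqxx (ord1 j).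
apply: smallest_sub; first exact: sigma_algebra_measurable.
move=> _ [B mB ->]; apply: fin_bigcap_measurable => // i _.
have mi : measurable_fun setT (fun u : 'cV[R]_n => u i 0%R).
  exact: measurable_mx_entry.
by rewrite -[X in measurable X]setTI; exact: mi.
Qed.

(** The law of the entries and their independence determine the probability of
boxes, hence the law of the vector. *)
Lemma std_gaussian_vector_law (X Y : {RV P >-> 'cV[R]_n}) :
  std_gaussian_vector X -> std_gaussian_vector Y ->
  forall B, measurable B -> P (X @^-1` B) = P (Y @^-1` B).
Proof.
move=> gX gY B mB.
have mX : measurable_fun setT X by exact: measurable_funPT.
have mY : measurable_fun setT Y by exact: measurable_funPT.
rewrite -[LHS]/(law P mX B) -[RHS]/(law P mY B).
apply: (measure_unique boxes (fun=> setT) measurable_boxes) => //.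
- by apply/seteqP; split => // x _; exists 0%N.
- move=> _ [C mC ->].
  have box (Z : {RV P >-> 'cV[R]_n}) : std_gaussian_vector Z ->
      P (Z @^-1` (\bigcap_(i in setT) (fun u : 'cV[R]_n => u i 0%R) @^-1` C i)) =
      (\prod_(i <- enum 'I_n) fine (normal_prob 0 1 (C i)))%:E.
    move=> [ZN Zi].
    rewrite (_ : Z @^-1` _ = \bigcap_(i in [set` enum 'I_n])
        (fun omega => Z omega i 0%R) @^-1` C i); last first.
      apply/seteqP; split => omega H i ?; apply: H => //=.
      by rewrite mem_enum.
    rewrite Zi ?enum_uniq//; last by move=> j _; exists (C j) => //; rewrite setTI.
    by congr EFin; apply: eq_bigr => i _; rewrite ZN.
  by rewrite -[LHS]/(P (X @^-1` _)) -[RHS]/(P (Y @^-1` _)) !box.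
- by move=> k; rewrite -[X in X < _]/(P (X @^-1` setT)) preimage_setT probability_setT ltry.
Qed.

End same_law.

Section product_probability.
Local Open Scope ereal_scope.
Context d1 d2 (T1 : measurableType d1) (T2 : measurableType d2) (R : realType).
Variables (P1 : probability T1 R) (P2 : probability T2 R).

Let product_setT : (P1 \x P2) setT = 1.
Proof.
rewrite -setXTT; apply: etrans (product_measure1E _ _ _ _) _ => //.
by rewrite -[X in X * _ = _]/(P1 setT) -[X in _ * X = _]/(P2 setT) !probability_setT mule1.
Qed.

HB.instance Definition _ :=
  Measure_isProbability.Build _ _ _ (P1 \x P2) product_setT.

Definition product_probability : probability (T1 * T2)%type R := P1 \x P2.

Lemma product_probabilityE A :
  product_probability A = \int[P1]_x P2 [set y | A (x, y)].
Proof.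
apply: eq_integral => x _ /=; congr (P2 _).
by apply/seteqP; split => y; rewrite /xsection /= inE.
Qed.

Lemma ge0_integral_product_probability (f : T1 * T2 -> \bar R) :
  measurable_fun setT f -> (forall z, 0 <= f z) ->
  \int[product_probability]_z f z = \int[P1]_x \int[P2]_y f (x, y).
Proof. by move=> mf f0; exact: (fubini_tonelli1 f mf f0). Qed.

End product_probability.

Section invariant_law.
Local Open Scope ereal_scope.
Context d d1 d2 (Omega : measurableType d) (T1 : measurableType d1)
  (T2 : measurableType d2) (R : realType) (P : probability Omega R).
Variables (X : Omega -> T2) (F : T1 * T2 -> T1) (nu : probability T1 R).
Hypotheses (mX : measurable_fun setT X) (mF : measurable_fun setT F).
Hypothesis nu_inv : forall B, measurable B ->
  nu B = \int[nu]_s P [set omega | B (F (s, X omega))].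

(** Invariance says that the step map F pushes the product of nu and the noise
law to nu; the formula is the change of variables followed by Tonelli. *)
Lemma ge0_integral_invariant (g : T1 -> \bar R) :
  measurable_fun setT g -> (forall s, 0 <= g s) ->
  \int[nu]_s g s = \int[nu]_s \int[P]_omega g (F (s, X omega)).
Proof.
move=> mg g0; pose M := product_probability nu (law P mX).
transitivity (\int[law M mF]_s g s).
  apply: eq_measure_integral => B mB _.
  rewrite -[LHS]/(nu B) nu_inv// -[RHS]/(M (F @^-1` B)).
  by rewrite product_probabilityE.
have mgF : measurable_fun setT (fun z => g (F z)) by exact: measurableT_comp.
rewrite ge0_integral_law// ge0_integral_product_probability//.
apply: eq_integral => s _; rewrite ge0_integral_law//.
exact: (measurable_fun_pair2 s mgF).
Qed.

End invariant_law.

Section sequence_space.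
Local Open Scope ereal_scope.
Context d (Omega : measurableType d) (R : realType) (P : probability Omega R).
Context d1 (U : measurableType d1) (eta : nat -> Omega -> U).
Hypothesis meta : forall k, measurable_fun setT (eta k).
Hypothesis eta_law : forall k B, measurable B -> P (eta k @^-1` B) = P (eta 0%N @^-1` B).
Hypothesis eta_indep : forall k B, (forall j, measurable (B j)) ->
  P (\bigcap_(j in `I_k) eta j @^-1` B j) =
  (\prod_(j < k) fine (P (eta j @^-1` B j)))%:E.

(** Generates the product sigma-algebra on sequences. *)
Definition all_cylinders : set (set (nat -> U)) :=
  \bigcup_k cylinders (fun j (x : nat -> U) => x j) k.

Local Notation Seq := (g_sigma_algebraType all_cylinders).

Lemma all_cylindersI : setI_closed all_cylinders.
Proof.
move=> A B [k _ kA] [m _ mB]; exists (maxn k m) => //.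
apply: cylindersI.
  exact: cylindersS (leq_maxl _ _) _ kA.
exact: cylindersS (leq_maxr _ _) _ mB.
Qed.

Lemma measurable_seq_coord j : measurable_fun setT (fun x : Seq => x j).
Proof.
move=> _ B mB; rewrite setTI; apply: sub_sigma_algebra; exists j.+1 => //.
exact: (cylinders_last (fun j (x : nat -> U) => x j)).
Qed.

Lemma measurable_fun_seq d' (T : measurableType d') (f : T -> Seq) :
  (forall j, measurable_fun setT (fun t => f t j)) -> measurable_fun setT f.
Proof.
move=> mf; apply: measurability; first reflexivity.
move=> _ [_ [k _ [B mB ->]] <-]; rewrite setTI preimage_bigcap.
apply: fin_bigcap_measurable; first exact: finite_II.
by move=> j _; rewrite -[X in measurable X]setTI; exact: mf.
Qed.

Definition seq_cons (z : Seq * U) : Seq := fun j => if j is j'.+1 then z.1 j' else z.2.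

Lemma measurable_seq_cons : measurable_fun setT seq_cons.
Proof.
apply: measurable_fun_seq => -[|j] /=; first exact: measurable_snd.
exact: (measurableT_comp (measurable_seq_coord j)).
Qed.

Definition noise_seq (omega : Omega) : Seq := fun j => eta j omega.

Lemma measurable_noise_seq : measurable_fun setT noise_seq.
Proof. exact: measurable_fun_seq. Qed.

Local Notation M := (law P measurable_noise_seq).
Local Notation L := (law P (meta 0)).

(** The law M of the sequence of independent, equally distributed noises is
preserved by prepending an independent copy of the noise. On a cylinder over
k+1 positions both sides are the product of the k+1 marginal probabilities. *)
Lemma noise_seq_shift A : measurable A ->
  M A = \int[M]_x P [set omega | A (seq_cons (x, eta 0%N omega))].
Proof.
move=> mA.
transitivity (law (product_probability M L) measurable_seq_cons A); last first.
  apply: eq_integral => x _ /=; rewrite /xsection -[LHS]/(P _); congr (P _).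
  by apply/seteqP; split => omega /=; rewrite inE.
have mE : @measurable _ Seq = <<s all_cylinders >> by [].
apply: (@measure_unique _ R Seq all_cylinders (fun=> setT) mE _ _ _
  M (law (product_probability M L) measurable_seq_cons)) => //.
- exact: all_cylindersI.
- by move=> _; exists 0%N => //; exact: cylindersT.
- by apply/seteqP; split => // x _; exists 0%N.
- move=> C [k _ kC].
  (* Widening the base makes it nonempty, so that position 0, which holds the new
     noise, can be separated. *)
  have [B mB ->] := cylindersS (leqnSn k) kC.
  rewrite -[LHS]/(P (\bigcap_(j in `I_k.+1) eta j @^-1` B j)) eta_indep//.
  rewrite -[RHS]/((M \x L) (seq_cons @^-1` _)).
  rewrite (_ : seq_cons @^-1` _ =
    (\bigcap_(j in `I_k) (fun x : nat -> U => x j) @^-1` B j.+1) `*` B 0%N); last first.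
    apply/seteqP; split => [[x u] H|[x u] [H Bu] [|j] //= jk]; last exact: H.
    by split => [j jk|]; [exact: (H j.+1)|exact: (H 0%N)].
  have mC' : measurable (\bigcap_(j in `I_k) (fun x : Seq => x j) @^-1` B j.+1).
    apply: fin_bigcap_measurable; first exact: finite_II.
    by move=> j _; rewrite -[X in measurable X]setTI; exact: measurable_seq_coord.
  apply/esym; apply: etrans (product_measure1E _ _ mC' (mB 0%N)) _.
  rewrite -[X in X * _]/(P (\bigcap_(j in `I_k) eta j @^-1` B j.+1)) eta_indep//.
  rewrite -[X in _ * X]/(P (eta 0%N @^-1` B 0%N)).
  have meB j : measurable (eta j @^-1` B j).
    by rewrite -[X in measurable X]setTI; exact: meta.
  rewrite big_ord_recl EFinM muleC fineK ?fin_num_measure//; congr (_ * _).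
  congr EFin; apply: eq_bigr => j _; congr fine.
  by rewrite eta_law // [RHS]eta_law.
- by move=> k; rewrite -[X in X < _]/(P setT) probability_setT ltry.
Qed.

Context d2 (T : measurableType d2) (F : T * U -> T) (Phi : Seq -> T).
Hypotheses (mF : measurable_fun setT F) (mPhi : measurable_fun setT Phi).
Hypothesis Phi_fixed : {ae M, forall x, forall u, Phi (seq_cons (x, u)) = F (Phi x, u)}.

(** By the shift invariance of M, Phi x has the same law as Phi of the sequence
with a fresh noise u prepended, which is the step from Phi x with noise u. *)
Lemma invariant_law_of_fixed_point B : measurable B ->
  law M mPhi B = \int[law M mPhi]_s P [set omega | B (F (s, eta 0%N omega))].
Proof.
move=> mB.
have mFB : measurable (F @^-1` B) by rewrite -[X in measurable X]setTI; exact: mF.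
have mk : measurable_fun setT (fun s => P [set omega | B (F (s, eta 0%N omega))]).
  rewrite (_ : (fun s => _) = L \o xsection (F @^-1` B)).
    exact: measurable_fun_xsection.
  apply/funext => s; rewrite /= /xsection.
  by rewrite -[RHS]/(P _); congr (P _); apply/seteqP; split => omega /=; rewrite inE.
rewrite ge0_integral_law//.
have mA : measurable (Phi @^-1` B) by rewrite -[X in measurable X]setTI; exact: mPhi.
rewrite -[LHS]/(M (Phi @^-1` B)) noise_seq_shift//.
apply: ge0_ae_eq_integral => //.
- rewrite (_ : (fun x => _) = L \o xsection (seq_cons @^-1` (Phi @^-1` B))).
    apply: measurable_fun_xsection.
    by rewrite -[X in measurable X]setTI; exact: measurable_seq_cons.
  apply/funext => s; rewrite /= /xsection.
  by rewrite -[RHS]/(P _); congr (P _); apply/seteqP; split => omega /=; rewrite inE.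
- exact: (measurableT_comp mk).
- apply: filterS Phi_fixed => x H _; congr (P _).
  by apply/seteqP; split => omega /=; rewrite H.
Qed.

End sequence_space.

(** * Stability of the coordinate recursion *)

(** The noiseless recursion in one coordinate, with q standing for 1 / alpha. The
scalars range over any numeric field so that the map acts both on real states
and on complex eigenvectors. *)
Definition coord_map (F : numFieldType) (p t q : F) (s : F * F) : F * F :=
  (p * (s.2 + t * s.1), (q + 1) * (p * (s.2 + t * s.1)) - q * s.1).

(** The map contracts the maximum norm by the factor h: p (1 + t) bounds the new
e, and (q + 1) p (1 + t) + q the new w. *)
Lemma coord_map_contract (F : numFieldType) (p t q h m : F) (s : F * F) :
  0 <= p -> 0 <= t -> 0 <= q -> (q + 1) * (p * (1 + t)) + q <= h ->
  `|s.1| <= m -> `|s.2| <= m ->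
  `|(coord_map p t q s).1| <= h * m /\ `|(coord_map p t q s).2| <= h * m.
Proof.
case: s => e w /= p0 t0 q0 hh em wm.
have m0 : 0 <= m by exact: le_trans em.
have pt0 : 0 <= p * (1 + t) by rewrite mulr_ge0// addr_ge0.
have h1 : `|p * (w + t * e)| <= p * (1 + t) * m.
  rewrite normrM ger0_norm// -mulrA ler_wpM2l//.
  rewrite (le_trans (ler_normD _ _))// normrM (ger0_norm t0) mulrDl mul1r lerD//.
  by rewrite ler_wpM2l.
split.
  apply: le_trans h1 _; rewrite ler_wpM2r//; apply: le_trans hh.
  by rewrite mulrDl mul1r addrAC lerDr addr_ge0// mulr_ge0.
rewrite (le_trans (ler_normB _ _))// normrM (ger0_norm (addr_ge0 q0 ler01)).
rewrite (normrM q e) (ger0_norm q0) (le_trans _ (ler_wpM2r m0 hh))// [leRHS]mulrDl lerD//.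
  by rewrite -[leRHS]mulrA ler_wpM2l// addr_ge0.
by rewrite ler_wpM2l.
Qed.

Section coord_rate.
Context {R : realType}.
Variables (mu gamma alpha a : R).
Hypotheses (mu0 : 0 < mu) (gamma0 : 0 < gamma) (alpha1 : 1 <= alpha) (a_mu : mu <= a).

(** As 1 / alpha + 1 <= 2 and the gain is at most gamma / (mu alpha), the factor
of [coord_map_contract] is at most this constant over alpha. *)
Definition rate_const : R := 2 * (gamma / mu) * (1 + tau_max mu gamma) + 1.

Lemma coord_rate_le :
  (alpha^-1 + 1) * (gain mu gamma alpha a * (1 + tau mu gamma alpha)) + alpha^-1 <=
  rate_const / alpha.
Proof.
have alpha0 : 0 < alpha by exact: lt_le_trans alpha1.
have q0 : 0 < alpha^-1 by rewrite invr_gt0.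
have q1 : alpha^-1 <= 1 by rewrite invf_le1.
have t0 := ltW (tau_gt0 mu0 gamma0 alpha0); have t1 := tau_le_max mu gamma alpha1.
have p0 := ltW (gain_gt0 mu0 gamma0 alpha1 a_mu).
have p1 := gain_le mu0 gamma0 alpha1 a_mu.
rewrite /rate_const [leRHS]mulrDl mul1r lerD2r.
have -> : 2 * (gamma / mu) * (1 + tau_max mu gamma) / alpha =
  2 * (gamma / mu / alpha * (1 + tau_max mu gamma)) by ring.
apply: ler_pM.
- by rewrite addr_ge0// ltW.
- by rewrite mulr_ge0// addr_ge0.
- by lra.
- by apply: ler_pM => //; [exact: addr_ge0|rewrite lerD2l].
Qed.

Hypothesis alpha_large : 2 * rate_const <= alpha.

Lemma coord_rate_half :
  (alpha^-1 + 1) * (gain mu gamma alpha a * (1 + tau mu gamma alpha)) + alpha^-1 <= 2^-1.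
Proof.
apply: le_trans coord_rate_le _.
have alpha0 : 0 < alpha by exact: lt_le_trans alpha1.
by rewrite ler_pdivrMr// mulrC ler_pdivlMr// mulrC.
Qed.

Lemma transition_mxE k j :
  transition_mx mu gamma alpha a k j =
  let s := coord_map (gain mu gamma alpha a) (tau mu gamma alpha) alpha^-1
             ((k == 0)%:R, (k == 1)%:R) in
  if j == 0 then s.1 else s.2.
Proof.
have alpha0 : 0 < alpha by exact: lt_le_trans alpha1.
have a0 : 0 < a by exact: lt_le_trans a_mu.
have t0 := tau_gt0 mu0 gamma0 alpha0.
rewrite /transition_mx mxE /coord_step !mxE /coord_map /=.
have E0 : (0 == k) = (k == 0) by rewrite eq_sym.
have E1 : (1 == k) = (k == 1) by rewrite eq_sym.
have t1 : 1 + tau mu gamma alpha != 0 by rewrite gt_eqF// addr_gt0.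
have ha : gamma * (1 + tau mu gamma alpha) + alpha * a != 0.
  by rewrite gt_eqF// addr_gt0// mulr_gt0// addr_gt0.
have hg : gamma != 0 by rewrite gt_eqF.
have haa : alpha != 0 by rewrite gt_eqF.
rewrite E0 E1 /gain /stepsize.
move: ((k == 0)%:R : R) ((k == 1)%:R : R) => x y.
by case: ifP => _; field; rewrite ?ha ?t1 ?hg ?haa.
Qed.

(** A left eigenvector v of eigenvalue z is a state that one step multiplies by z.
Looking at its component of largest modulus, which is nonzero, and using the
contraction gives |z| <= 1/2. *)
Lemma stable_transition : stable (transition_mx mu gamma alpha a).
Proof.
have alpha0 : 0 < alpha by exact: lt_le_trans alpha1.
rewrite /stable; move: (transition_mx mu gamma alpha a) transition_mxE => M ME.
have eig (z : R[i]) : eigenvalue (map_mx (real_complex R) M) z ->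
    complex.Re `|z| <= 2^-1.
  move=> /eigenvalueP[v vM v0].
  pose p : R[i] := (gain mu gamma alpha a)%:C%C.
  pose t : R[i] := (tau mu gamma alpha)%:C%C.
  pose q : R[i] := (alpha^-1)%:C%C.
  have step_v : (z * v 0 0, z * v 0 1) = coord_map p t q (v 0 0, v 0 1).
    have vM0 := congr1 (fun u : 'rV_2 => u 0 0) vM.
    have vM1 := congr1 (fun u : 'rV_2 => u 0 1) vM.
    move: vM0 vM1; rewrite !mxE !big_ord_recl !big_ord0 !mxE !ME /=.
    rewrite (_ : ord0 = 0 :> 'I_2); last exact/val_inj.
    rewrite (_ : lift 0 0 = 1 :> 'I_2); last exact/val_inj.
    rewrite /coord_map /= !(mulr0, mulr1, add0r, addr0, subr0).
    rewrite {}/p {}/t {}/q.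
    move: (gain _ _ _ _) (tau _ _ _) (alpha^-1) => p t q.
    rewrite !(rmorphB, rmorphD, rmorphM, rmorph1) /=.
    by move=> <- <-; congr pair; ring.
  have p0 : 0 <= p by rewrite lecR ltW// gain_gt0.
  have t0 : 0 <= t by rewrite lecR ltW// tau_gt0.
  have q0 : 0 <= q by rewrite lecR invr_ge0 ltW.
  have h : (q + 1) * (p * (1 + t)) + q <= (2^-1)%:C%C.
    rewrite /p /t /q; move: coord_rate_half.
    move: (gain _ _ _ _) (tau _ _ _) (alpha^-1) => P T Q'.
    by rewrite -lecR !(rmorphD, rmorphM, rmorph1).
  have half (m : R[i]) : 0 < m -> `|v 0 0| <= m -> `|v 0 1| <= m ->
      m = `|v 0 0| \/ m = `|v 0 1| -> complex.Re `|z| <= 2^-1.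
    move=> m0 v0m v1m mE.
    have := coord_map_contract p0 t0 q0 h (s := (v 0 0, v 0 1)) v0m v1m.
    rewrite -step_v /= !normrM => -[h0 h1].
    have : `|z| <= (2^-1)%:C%C.
      by rewrite -(ler_pM2r m0); case: mE => mE; rewrite {1}mE.
    by rewrite lecE => /andP[].
  have [v01|/ltW v10] := real_leP (normr_real (v 0 0)) (normr_real (v 0 1)).
    apply: (half `|v 0 1|) => //; last by right.
    rewrite normr_gt0; apply: contraNneq v0 => v1; apply/eqP/matrixP => i j.
    move: v01; rewrite v1 normr0 normr_le0 => /eqP v0'.
    rewrite (ord1 i) !mxE; case: (unliftP 0 j) => [k ->|->//].
    by rewrite (ord1 k) (_ : lift 0 0 = 1 :> 'I_2)//; exact/val_inj.
  apply: (half `|v 0 0|) => //; last by left.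
  rewrite normr_gt0; apply: contraNneq v0 => v0'; apply/eqP/matrixP => i j.
  move: v10; rewrite v0' normr0 normr_le0 => /eqP v1.
  rewrite (ord1 i) !mxE; case: (unliftP 0 j) => [k ->|->//].
  by rewrite (ord1 k) (_ : lift 0 0 = 1 :> 'I_2)//; exact/val_inj.
apply: (@le_lt_trans _ _ (2^-1 : R)); last by rewrite invf_lt1// ltr1n.
rewrite /spectral_radius; set E := (X in sup X).
have [->|nz] := eqVneq E set0; first by rewrite sup0 invr_ge0.
apply: ge_sup; first exact/set0P.
by move=> _ [z /= zM <-]; exact: eig.
Qed.

End coord_rate.

(** * Existence of a stationary law *)

Lemma integrable_lty_ae d (T : measurableType d) (R : realType)
    (mu : {measure set T -> \bar R}) (f : T -> \bar R) :
  measurable_fun setT f -> (forall x, 0 <= f x)%E -> (\int[mu]_x f x < +oo)%E ->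
  {ae mu, forall x, (f x < +oo)%E}.
Proof.
move=> mf f0 foo.
have fi : mu.-integrable setT f.
  apply/integrableP; split => //.
  by under eq_integral do rewrite gee0_abs//.
apply: filterS (integrable_ae measurableT fi) => x /(_ I).
by rewrite ltey_eq => ->.
Qed.

Lemma cvg_series_weighted (R : realType) (c z u : R^nat) (B : R) :
  0 <= B -> (forall j, `|c j * z j| <= B * u j) -> (forall j, 0 <= u j) ->
  (\sum_(0 <= j <oo) (u j)%:E < +oo)%E ->
  cvgn (series (fun j => c j * z j)).
Proof.
move=> B0 cu u0 uoo; apply: normed_cvg.
apply: nondecreasing_is_cvgn.
  by apply: nondecreasing_series => k _ _ /=; exact: normr_ge0.
exists (B * fine (\sum_(0 <= j <oo) (u j)%:E)) => _ [k _ <-].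
rewrite /series /=; apply: (@le_trans _ _ (B * \sum_(0 <= j < k) u j)).
  by rewrite mulr_sumr; apply: ler_sum => j _; exact: cu.
rewrite ler_wpM2l// -lee_fin fineK.
  rewrite -sumEFin; apply: nneseries_lim_ge => j _ _; by rewrite lee_fin.
by rewrite ge0_fin_numE// nneseries_ge0// => j _ _; rewrite lee_fin.
Qed.

Section stationary_existence.
Context d (Omega : measurableType d) (R : realType) (P : probability Omega R).
Context (n : nat) (eta : nat -> {RV P >-> 'cV[R]_n}).
Variables (mu gamma alpha rho : R) (A Q : 'M[R]_n) (a : 'rV[R]_n) (b : 'cV[R]_n).
Hypotheses (mu0 : 0 < mu) (gamma0 : 0 < gamma) (alpha1 : 1 <= alpha).
Hypotheses (diagA : orthogonal_diagonalization A Q a).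
Hypothesis a_mu : forall i, mu <= a 0 i.
Hypothesis eta_iid : iid_std_gaussian eta.
Hypothesis alpha_large : 2 * rate_const mu gamma <= alpha.

Let alpha0 : 0 < alpha. Proof. exact: lt_le_trans alpha1. Qed.
Let a0 i : 0 < a 0 i. Proof. exact: lt_le_trans (a_mu i). Qed.
Let QTQ : Q^T *m Q = 1%:M. Proof. by case: diagA. Qed.

Local Notation state := ('cV[R]_n * 'cV[R]_n)%type.
Local Notation step := (scheme_step mu gamma alpha rho (quad A b)).
Local Notation t := (tau mu gamma alpha).
Local Notation p i := (gain mu gamma alpha (a 0 i)).
Local Notation cmap i := (coord_map (p i) t alpha^-1).

(* The effect of a unit noise on the position coordinate within the same step. *)
Let kick (i : 'I_n) : R := p i * (Num.sqrt alpha * rho).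

(* The state of the coordinate i, j steps after a unit noise hits it at rest. The
   noise enters w' through e', whence the second component for j = 0. *)
Let response i j : R * R := iter j (cmap i) (kick i, (alpha^-1 + 1) * kick i).

Let bound i : R := 2 * `|kick i|.

Let response_le i j : `|(response i j).1| <= 2^-1 ^+ j * bound i /\
                      `|(response i j).2| <= 2^-1 ^+ j * bound i.
Proof.
have q0 : 0 <= alpha^-1 by rewrite invr_ge0 ltW.
have q1 : alpha^-1 <= 1 by rewrite invf_le1.
elim: j => [|j [IH1 IH2]].
  rewrite /response /= expr0 mul1r /bound; split.
    by rewrite -[leLHS]mul1r ler_wpM2r// ler1n.
  by rewrite normrM ger0_norm ?addr_ge0// ler_wpM2r//; lra.
rewrite /response iterS -/(response i j) exprS -mulrA.
apply: coord_map_contract => //.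
- exact: ltW (gain_gt0 _ _ _ _).
- exact: ltW (tau_gt0 _ _ _).
- exact: coord_rate_half.
Qed.

Local Notation U := 'cV[R]_n.
Local Notation Seq := (g_sigma_algebraType (@all_cylinders _ U)).

Let zeta i (x : Seq) j : R := (Q^T *m x j) i 0.

Let mQ i : measurable_fun setT (fun u : U => (Q^T *m u) i 0).
Proof.
under eq_fun do rewrite mxE.
apply: measurable_sum => j; apply: measurable_funM => //.
exact: measurable_mx_entry.
Qed.

Let mzeta i j : measurable_fun setT (fun x : Seq => zeta i x j).
Proof. exact: (measurableT_comp (mQ i) (measurable_seq_coord j)). Qed.

(* The responses decay like 2^-j, so they are summable against a noise sequence x
   as soon as its weights are. The factor 2^-(j+1) makes the weights summable in
   mean, the noise having bounded first moments. *)
Let weight (x : Seq) j : R := (\sum_i `|zeta i x j|) / (2 ^ j.+1)%:R.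

Let weight_ge0 x j : 0 <= weight x j.
Proof. by rewrite divr_ge0// sumr_ge0. Qed.

Let mweight j : measurable_fun setT (fun x : Seq => weight x j).
Proof.
apply: measurable_funM => //; apply: measurable_sum => i.
exact: measurableT_comp.
Qed.

Let total (x : Seq) : \bar R := (\sum_(0 <= j <oo) (weight x j)%:E)%E.

Let mtotal : measurable_fun setT total.
Proof.
apply: ge0_emeasurable_sum => [j x _ _|j _]; first by rewrite lee_fin.
exact/measurable_EFinP.
Qed.

Let good : set Seq := [set x | (total x < +oo)%E].

Let mgood : measurable good.
Proof.
rewrite -[good]setTI; exact: (emeasurable_fun_infty_o measurableT mtotal).
Qed.

(** Prepending a term delays each noise by one step, which halves its weight. *)
Let good_cons (x : Seq) (u : U) : good x -> good (seq_cons (x, u)).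
Proof.
rewrite /good /= /total => xoo.
rewrite nneseries_recl//; last by move=> k _; rewrite lee_fin.
rewrite lte_add_pinfty ?ltry//.
rewrite -nneseries_addn; last by move=> k; rewrite lee_fin.
apply: le_lt_trans xoo; apply: lee_nneseries => [k _ _|k _].
  by rewrite lee_fin.
rewrite addn1 lee_fin /weight /= ler_wpM2l ?sumr_ge0// lef_pV2 ?posrE ?ltr0n ?expn_gt0//.
by rewrite ler_nat leq_exp2l.
Qed.

Let meta k : measurable_fun setT (eta k). Proof. exact: measurable_funPT. Qed.

Local Notation M := (law P (measurable_noise_seq meta)).

(** |z| <= 1 + z^2, written as a sum of two squares of affine functions of z. *)
Let int_zeta_le i j : (\int[M]_x `|zeta i x j|%:E <= 2%:E)%E.
Proof.
have m1 : measurable_fun setT (fun x : Seq => `|zeta i x j|%:E).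
  by apply/measurable_EFinP; exact: measurableT_comp.
rewrite ge0_integral_law//.
have mz : measurable_fun setT (fun omega => (Q^T *m eta j omega) i 0).
  exact: (measurableT_comp (mQ i)).
apply: (@le_trans _ _ (\int[P]_omega ((1 + 0 * (Q^T *m eta j omega) i 0) ^+ 2 +
   (0 + 1 * (Q^T *m eta j omega) i 0) ^+ 2)%:E)%E).
  apply: ge0_le_integral => //.
  - by apply/measurable_EFinP; exact: measurableT_comp.
  - apply/measurable_EFinP; apply: measurable_funD; apply: measurable_funX;
      by apply: measurable_funD => //; exact: measurable_funM.
  - move=> omega _; rewrite lee_fin /zeta /noise_seq.
    move: ((Q^T *m _) i 0) => z; rewrite mul0r addr0 add0r mul1r expr1n.
    have := sqr_ge0 (`|z| - 1); rewrite -(real_normK (num_real z)).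
    by have := normr_ge0 z; nra.
under eq_integral do rewrite EFinD.
rewrite ge0_integralD//.
- rewrite !(orthogonal_second_moment _ _ _ QTQ (eta_iid.1 j)) -EFinD lee_fin.
  by rewrite !expr1n !expr0n /=; lra.
- by move=> omega _; rewrite lee_fin sqr_ge0.
- apply/measurable_EFinP; apply: measurable_funX.
  by apply: measurable_funD => //; exact: measurable_funM.
- by move=> omega _; rewrite lee_fin sqr_ge0.
- apply/measurable_EFinP; apply: measurable_funX.
  by apply: measurable_funD => //; exact: measurable_funM.
Qed.

Let good_ae : {ae M, forall x, good x}.
Proof.
apply: integrable_lty_ae => //.
  by move=> x; apply: nneseries_ge0 => j _ _; rewrite lee_fin.
rewrite /total integral_nneseries//; last 2 first.
- by move=> j; exact/measurable_EFinP.
- by move=> j x _; rewrite lee_fin.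
apply: (@le_lt_trans _ _ (\sum_(0 <= j <oo) ((2 * n%:R) / (2 ^ j.+1)%:R)%:E)%E).
  apply: lee_nneseries => [j _ _|j _].
    by apply: integral_ge0 => x _; rewrite lee_fin.
  under eq_integral do rewrite /weight mulrC mulr_sumr -sumEFin.
  rewrite ge0_integral_sum//; last first.
    by move=> i; apply/measurable_EFinP; apply: measurable_funM => //; exact: measurableT_comp.
  apply: (@le_trans _ _ (\sum_(i < n) ((2 ^ j.+1)%:R^-1 * 2)%:E)%E).
    apply: lee_sum => i _; under eq_integral do rewrite EFinM.
    rewrite ge0_integralZl//.
    - by rewrite EFinM lee_wpmul2l// lee_fin.
    - by apply/measurable_EFinP; exact: measurableT_comp.
  by rewrite sumEFin lee_fin sumr_const card_ord -mulr_natr; lra.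
apply: le_lt_trans (epsilon_trick0 _ _) _; last exact: ltry.
by rewrite mulr_ge0.
Qed.

Let cvg_response (proj : R * R -> R) i x : good x ->
  (forall j, `|proj (response i j)| <= 2^-1 ^+ j * bound i) ->
  cvgn (series (fun j => proj (response i j) * zeta i x j)).
Proof.
move=> gx rb.
apply: (cvg_series_weighted (B := 2 * bound i) (u := weight x)) => //.
  by rewrite mulr_ge0// /bound mulr_ge0.
move=> j; rewrite normrM /weight.
have -> : 2 * bound i * ((\sum_k `|zeta k x j|) / (2 ^ j.+1)%:R) =
   2^-1 ^+ j * bound i * \sum_k `|zeta k x j|.
  by rewrite expnS natrM natrX exprVn; field; rewrite expf_neq0//= pnatr_eq0.
apply: ler_pM => //.
by rewrite (bigD1 i)//= lerDl sumr_ge0.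
Qed.

(* Multiplication by the indicator makes the partial sums converge everywhere, so
   that the limit is measurable. *)
Let partial (proj : R * R -> R) i k (x : Seq) : R :=
  \1_good x * series (fun j => proj (response i j) * zeta i x j) k.

Let limit (proj : R * R -> R) i (x : Seq) : R := limn (partial proj i ^~ x).

Let cvg_limit proj i x : good x ->
  (forall j, `|proj (response i j)| <= 2^-1 ^+ j * bound i) ->
  series (fun j => proj (response i j) * zeta i x j) @ \oo --> limit proj i x.
Proof.
move=> gx rb.
have -> : limit proj i x = limn (series (fun j => proj (response i j) * zeta i x j)).
  rewrite /limit; congr (limn _); apply/funext => k.
  by rewrite /partial indicE mem_set// mul1r.
exact: cvg_response.
Qed.

Let mlimit proj i :
  (forall j, `|proj (response i j)| <= 2^-1 ^+ j * bound i) ->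
  measurable_fun setT (limit proj i).
Proof.
move=> rb; apply: (measurable_fun_cvg (h := partial proj i)).
  move=> k; apply: measurable_funM; first exact: measurable_indic.
  rewrite /series /=; apply: measurable_sum => j.
  exact: measurable_funM.
move=> x _.
have [gx|bx] := pselect (good x).
  rewrite (_ : partial proj i ^~ x =
    series (fun j => proj (response i j) * zeta i x j)).
    exact: cvg_limit.
  by apply/funext => k; rewrite /partial indicE mem_set// mul1r.
have p0 : partial proj i ^~ x = fun=> 0.
  by apply/funext => k; rewrite /partial indicE memNset// mul0r.
by rewrite /limit p0 lim_cst//; exact: cvg_cst.
Qed.

Let rb1 i j : `|(response i j).1| <= 2^-1 ^+ j * bound i.
Proof. by have [] := response_le i j. Qed.
Let rb2 i j : `|(response i j).2| <= 2^-1 ^+ j * bound i.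
Proof. by have [] := response_le i j. Qed.

Let E i (x : Seq) : R := limit fst i x.
Let W i (x : Seq) : R := limit snd i x.

Let series_cons proj i (x : Seq) u k :
  series (fun j => proj (response i j) * zeta i (seq_cons (x, u)) j) k.+1 =
  proj (response i 0%N) * (Q^T *m u) i 0 +
  series (fun j => proj (response i j.+1) * zeta i x j) k.
Proof. by rewrite /series /= big_nat_recl. Qed.

(** The term j = 0 of the series at (x, u) is the direct effect of u; the response
at j + 1 is the noiseless step applied to the response at j, and by linearity
the remaining series is the noiseless step applied to the series at x. *)
Let E_cons i (x : Seq) u : good x ->
  E i (seq_cons (x, u)) = kick i * (Q^T *m u) i 0 + p i * (W i x + t * E i x).
Proof.
move=> gx; have gc := good_cons u gx.
have := @cvg_limit fst i _ gc (rb1 i).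
move/(cvg_comp _ _ (cvg_addnr 1)) => H.
apply: (cvg_unique _ H) => //.
have e1 := @cvg_limit fst i x gx (rb1 i); have e2 := @cvg_limit snd i x gx (rb2 i).
rewrite (_ : _ \o _ = (fun k => kick i * (Q^T *m u) i 0 +
   p i * (series (fun j => (response i j).2 * zeta i x j) k +
          t * series (fun j => (response i j).1 * zeta i x j) k))); last first.
  apply/funext => k; rewrite /= addn1 series_cons /=; congr (_ + _).
  rewrite /series /= !mulr_sumr -big_split /= mulr_sumr; apply: eq_bigr => j _.
  by ring.
apply: cvgD; first exact: cvg_cst.
by apply: cvgMr; apply: cvgD => //; exact: cvgMr.
Qed.

Let W_cons i (x : Seq) u : good x ->
  W i (seq_cons (x, u)) = (alpha^-1 + 1) * E i (seq_cons (x, u)) - alpha^-1 * E i x.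
Proof.
move=> gx; have gc := good_cons u gx.
have := @cvg_limit snd i _ gc (rb2 i).
move/(cvg_comp _ _ (cvg_addnr 1)) => H.
apply: (cvg_unique _ H) => //.
have e1 := @cvg_limit fst i x gx (rb1 i).
have := @cvg_limit fst i _ gc (rb1 i).
move/(cvg_comp _ _ (cvg_addnr 1)) => e2.
rewrite (_ : _ \o _ = (fun k => (alpha^-1 + 1) *
    (series (fun j => (response i j).1 * zeta i (seq_cons (x, u)) j) \o addn^~ 1%N) k -
    alpha^-1 * series (fun j => (response i j).1 * zeta i x j) k)); last first.
  apply/funext => k; rewrite [LHS]/= [in RHS]/= addn1 !series_cons.
  have -> : series (fun j => (response i j.+1).2 * zeta i x j) k =
      (alpha^-1 + 1) * series (fun j => (response i j.+1).1 * zeta i x j) k -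
      alpha^-1 * series (fun j => (response i j).1 * zeta i x j) k.
    rewrite /series /= !mulr_sumr -sumrB; apply: eq_bigr => j _; ring.
  have -> : (response i 0).2 = (alpha^-1 + 1) * (response i 0).1 by [].
  by ring.
by apply: cvgB; exact: cvgMr.
Qed.

Let Phi (x : Seq) : state :=
  (xstar A b + Q *m (\col_i E i x), xstar A b + Q *m (\col_i W i x)).

Let mPhi : measurable_fun setT Phi.
Proof.
have H (f : 'I_n -> Seq -> R) : (forall i, measurable_fun setT (f i)) ->
    measurable_fun setT (fun x => xstar A b + Q *m (\col_i f i x)).
  move=> mf; apply: measurable_fun_mx => i j.
  rewrite (_ : (fun _ => _) = fun x => xstar A b i j + \sum_k Q i k * f k x).
    apply: measurable_funD => //; apply: measurable_sum => k.
    exact: measurable_funM.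
  apply/funext => x; rewrite !mxE; congr (_ + _).
  by apply: eq_bigr => k _; rewrite mxE.
by apply: measurable_fun_pair; apply: H => i; apply: mlimit;
  [exact: rb1|exact: rb2].
Qed.

Let eigen_coord_col (c : 'cV[R]_n) i :
  eigen_coord A Q b (xstar A b + Q *m c) i = c i 0.
Proof. by rewrite /eigen_coord addrC addKr mulmxA QTQ mul1mx. Qed.

Let Phi_fixed (x : Seq) u : good x -> Phi (seq_cons (x, u)) = step (Phi x) u.
Proof.
move=> gx.
have ext (y z : U) : (forall i, eigen_coord A Q b y i = eigen_coord A Q b z i) -> y = z.
  move=> yz; rewrite (eigen_coordK b diagA y) (eigen_coordK b diagA z).
  congr (_ + _ *m _); apply/matrixP => i j; rewrite mxE [RHS]mxE; exact: yz.
have Phi1 y i : eigen_coord A Q b (Phi y).1 i = E i y by rewrite eigen_coord_col mxE.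
have Phi2 y i : eigen_coord A Q b (Phi y).2 i = W i y by rewrite eigen_coord_col mxE.
have e1 i : eigen_coord A Q b (Phi (seq_cons (x, u))).1 i =
            eigen_coord A Q b (step (Phi x) u).1 i.
  rewrite (eigen_coord_step1 rho b mu0 gamma0 alpha0 diagA)// /drift.
  rewrite (Phi1 (seq_cons (x, u)) i) (Phi1 x i) (Phi2 x i) E_cons//.
  exact: addrC.
rewrite [RHS]surjective_pairing [LHS]surjective_pairing; congr pair; apply: ext => // i.
rewrite (eigen_coord_step2 rho b mu0 gamma0 alpha0 diagA)// -e1.
by rewrite Phi2 !Phi1 W_cons.
Qed.

Lemma stationary_law_exists :
  exists nu, stationary_law mu gamma alpha rho (quad A b) (eta 0%N) nu.
Proof.
exists (law M mPhi) => B mB.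
have ms := @measurable_step _ _ _ _ _ rho _ _ _ b mu0 gamma0 alpha0 diagA a0.
apply: (@invariant_law_of_fixed_point _ _ _ P _ _ _ meta _ _ _ _ _ _ ms mPhi) => //.
- by move=> k C mC; apply: std_gaussian_vector_law => //; exact: eta_iid.1.
- exact: iid_cylinder.
- by apply: filterS good_ae => x gx u; exact: Phi_fixed.
Qed.

End stationary_existence.

(** * Second moments of stationary laws *)

(** A Foster-Lyapunov argument that does not presuppose that h is integrable. *)
Section truncation.
Context d (T : measurableType d) (R : realType) (nu : probability T R).
Variables (h : T -> R) (eps C : R).
Hypotheses (mh : measurable_fun setT h) (h0 : forall s, 0 <= h s).
Hypotheses (eps0 : 0 <= eps) (eps1 : eps <= 2^-1) (C0 : 0 <= C).
Hypothesis drift_h : forall k : R, 0 <= k ->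
  (\int[nu]_s (Num.min k (h s))%:E <= \int[nu]_s (Num.min k (eps * h s + C))%:E)%E.

(* The part of h where the truncation at level k is not active. *)
Let below k : T -> R := fun s => \1_[set s | h s <= k] s * h s.

Let mbelow k : measurable_fun setT (below k).
Proof.
apply: measurable_funM => //; apply: measurable_indic.
rewrite -[X in measurable X]setTI.
have -> : [set s | h s <= k] = h @^-1` `]-oo, k].
  by apply/seteqP; split => s /=; rewrite in_itv.
by apply: mh => //; exact: measurable_itv.
Qed.

Let below_ge0 k s : 0 <= below k s.
Proof. by rewrite /below mulr_ge0. Qed.

Let min_integrable k (g : T -> R) : 0 <= k -> measurable_fun setT g ->
  (forall s, 0 <= g s) -> nu.-integrable setT (fun s => (Num.min k (g s))%:E).
Proof.
move=> k0 mg g0; apply: le_integrable (finite_measure_integrable_cst nu k measurableT) => //.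
  by apply/measurable_EFinP; exact: measurable_minr.
move=> s _ /=; rewrite lee_fin !ger0_norm//; last by rewrite le_min k0 g0.
by rewrite ge_min lexx.
Qed.

(** Where h <= k, the truncated h exceeds the truncated eps h + C by at least
(1 - eps) h - C; elsewhere it equals k and the difference is nonnegative. Since
truncated functions have finite integrals, the drift inequality can be
rearranged and bounds the integral of h over {h <= k}. *)
Let integral_below k : 0 <= k -> (\int[nu]_s (below k s)%:E <= (2 * C)%:E)%E.
Proof.
move=> k0.
have eh0 s : 0 <= eps * h s + C by rewrite addr_ge0// mulr_ge0.
have meh : measurable_fun setT (fun s => eps * h s + C).
  by apply: measurable_funD => //; exact: measurable_funM.
have i1 := min_integrable k0 mh h0.
have i2 := min_integrable k0 meh eh0.
have pw s : Num.min k (eps * h s + C) + 2^-1 * below k s <= Num.min k (h s) + C.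
  rewrite /below indicE; have x0 := h0 s.
  case: (boolP (s \in _)) => [|]; rewrite ?inE ?notin_setE /=.
    move: (h s) x0 => x x0 xk; rewrite (min_r xk) mul1r.
    have : Num.min k (eps * x + C) <= eps * x + C by rewrite ge_min lexx orbT.
    have : eps * x <= 2^-1 * x by rewrite ler_wpM2r.
    by lra.
  move: (h s) x0 => x x0 /negP; rewrite -ltNge => /ltW kx; rewrite (min_l kx) mul0r mulr0 addr0.
  have : Num.min k (eps * x + C) <= k by rewrite ge_min lexx.
  by move=> /le_trans; apply; rewrite lerDl.
have := drift_h k0.
rewrite -(fineK (integrable_fin_num measurableT i1)) -(fineK (integrable_fin_num measurableT i2)).
set psi := fine _; set chi := fine _; rewrite lee_fin => psi_chi.
have : (\int[nu]_s (Num.min k (eps * h s + C) + 2^-1 * below k s)%:E <=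
        \int[nu]_s (Num.min k (h s) + C)%:E)%E.
  apply: ge0_le_integral => //.
  - move=> s _; rewrite lee_fin addr_ge0//; first by rewrite le_min k0 eh0.
    by rewrite mulr_ge0.
  - apply/measurable_EFinP; apply: measurable_funD; first exact: measurable_minr.
    exact: measurable_funM.
  - by apply/measurable_EFinP; apply: measurable_funD => //; exact: measurable_minr.
  - by move=> s _; rewrite lee_fin.
have -> : (\int[nu]_s (Num.min k (eps * h s + C) + 2^-1 * below k s)%:E =
    chi%:E + (2^-1)%:E * \int[nu]_s (below k s)%:E)%E.
  under eq_integral do rewrite EFinD EFinM.
  rewrite ge0_integralD//.
  - rewrite ge0_integralZl//; first by rewrite /chi fineK// (integrable_fin_num _ i2).
    + exact/measurable_EFinP.
    + by move=> s _; rewrite lee_fin.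
  - by move=> s _; rewrite lee_fin le_min k0 eh0.
  - by apply/measurable_EFinP; exact: measurable_minr.
  - by move=> s _; rewrite -EFinM lee_fin mulr_ge0.
  - by apply/measurable_EFinP; exact: measurable_funM.
have -> : (\int[nu]_s (Num.min k (h s) + C)%:E = psi%:E + C%:E)%E.
  under eq_integral do rewrite EFinD.
  rewrite ge0_integralD//.
  - rewrite integral_cst//= probability_setT mule1.
    by rewrite /psi fineK// (integrable_fin_num _ i1).
  - by move=> s _; rewrite lee_fin le_min k0 h0.
  - by apply/measurable_EFinP; exact: measurable_minr.
have : (0 <= \int[nu]_s (below k s)%:E)%E.
  by apply: integral_ge0 => s _; rewrite lee_fin.
case: (\int[nu]_s (below k s)%:E)%E => [r| |] //.
  by rewrite -EFinM -!EFinD !lee_fin; lra.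
by rewrite gt0_muley ?lte_fin ?invr_gt0// addey// leye_eq.
Qed.

(** The bound on the part of h below the level k is uniform in k. *)
Lemma truncated_drift_bound : (\int[nu]_s (h s)%:E <= (2 * C)%:E)%E.
Proof.
have hE s : limn (fun k : nat => (below k%:R s)%:E) = (h s)%:E.
  apply/cvg_lim => //; apply: cvg_near_cst.
  exists (Num.truncn (h s)).+1 => // k /= hk.
  rewrite /below indicE mem_set ?mul1r//=.
  apply: ltW; apply: lt_le_trans (truncnS_gt _) _.
  by rewrite ler_nat.
under eq_integral do rewrite -hE.
rewrite monotone_convergence//; last 3 first.
- by move=> k; exact/measurable_EFinP.
- by move=> k s _; rewrite lee_fin.
- move=> s _ k m km; rewrite lee_fin /below ler_wpM2r// !indicE.
  case: (boolP (s \in _)) => //; rewrite inE /= => hk.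
  by rewrite mem_set//= (le_trans hk)// ler_nat.
apply: lime_le.
  apply: ereal_nondecreasing_is_cvgn => k m km; apply: ge0_le_integral => //.
  - by move=> s _; rewrite lee_fin.
  - exact/measurable_EFinP.
  - exact/measurable_EFinP.
  - move=> s _; rewrite lee_fin /below ler_wpM2r// !indicE.
    case: (boolP (s \in _)) => //; rewrite inE /= => hk.
    by rewrite mem_set//= (le_trans hk)// ler_nat.
by apply: nearW => k; exact: integral_below.
Qed.

End truncation.

Section stationary_moments.
Context d (Omega : measurableType d) (R : realType) (P : probability Omega R).
Context (n : nat) (X : {RV P >-> 'cV[R]_n}).
Variables (mu gamma alpha rho : R) (A Q : 'M[R]_n) (a : 'rV[R]_n) (b : 'cV[R]_n).
Hypotheses (mu0 : 0 < mu) (gamma0 : 0 < gamma) (alpha1 : 1 <= alpha).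
Hypotheses (diagA : orthogonal_diagonalization A Q a).
Hypothesis a_mu : forall i, mu <= a 0 i.
Hypothesis gX : std_gaussian_vector X.
Local Notation K := (contraction_const mu gamma).
Hypothesis alpha_large : 2 * K <= alpha.
Local Notation state := ('cV[R]_n * 'cV[R]_n)%type.
Local Notation step := (scheme_step mu gamma alpha rho (quad A b)).
Local Notation coord := (eigen_coord A Q b).
Local Notation p i := (gain mu gamma alpha (a 0 i)).
Variable nu : probability state R.
Hypothesis nu_stat : stationary_law mu gamma alpha rho (quad A b) X nu.

Let alpha0 : 0 < alpha. Proof. exact: lt_le_trans alpha1. Qed.
Let a0 i : 0 < a 0 i. Proof. exact: lt_le_trans (a_mu i). Qed.
Let mX : measurable_fun setT X. Proof. exact: measurable_funPT. Qed.
Let mstep : measurable_fun setT (fun z : state * 'cV[R]_n => step z.1 z.2).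
Proof. exact: (@measurable_step _ _ _ _ _ rho _ _ _ b mu0 gamma0 alpha0 diagA a0). Qed.

Lemma stationary_integral (g : state -> \bar R) :
  measurable_fun setT g -> (forall s, (0 <= g s)%E) ->
  (\int[nu]_s g s = \int[nu]_s \int[P]_omega g (step s (X omega)))%E.
Proof.
exact: (ge0_integral_invariant mX mstep nu_stat).
Qed.

Let energy (s : state) : R := \sum_i coord_energy A Q b i s.

Let menergy : measurable_fun setT energy.
Proof. by apply: measurable_sum => i; exact: measurable_coord_energy. Qed.

Let energy_ge0 s : 0 <= energy s.
Proof. by apply: sumr_ge0 => i _; exact: coord_energy_ge0. Qed.

Let C : R := K * (n%:R * rho ^+ 2) / alpha.
Let eps : R := K / alpha ^+ 2.

Let K0 : 0 < K. Proof. exact: contraction_const_gt0. Qed.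
Let C0 : 0 <= C.
Proof. by rewrite /C divr_ge0 ?(ltW alpha0)// mulr_ge0 ?(ltW K0)// mulr_ge0 ?sqr_ge0. Qed.
Let eps0 : 0 <= eps. Proof. by rewrite /eps divr_ge0 ?sqr_ge0 ?(ltW K0). Qed.
Let eps_half : eps <= 2^-1.
Proof.
rewrite /eps ler_pdivrMr ?exprn_gt0//; have := K0; have := alpha1; have := alpha_large.
by nra.
Qed.

Let mcoord1 i : measurable_fun setT (fun s : state => coord s.1 i).
Proof. exact: (measurableT_comp (measurable_eigen_coord A Q b i) measurable_fst). Qed.

Let m_after (g : state -> R) s : measurable_fun setT g ->
  measurable_fun setT (fun omega => g (step s (X omega))).
Proof.
move=> mg; apply: (measurableT_comp mg).
exact: (measurableT_comp (measurable_fun_pair2 s mstep)).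
Qed.

Let integral_energy_le s :
  (\int[P]_omega (energy (step s (X omega)))%:E <= (eps * energy s + C)%:E)%E.
Proof.
rewrite /energy; under eq_integral do rewrite -sumEFin.
rewrite ge0_integral_sum//; last 2 first.
- by move=> i; apply/measurable_EFinP; apply: (m_after s (measurable_coord_energy A Q b i)).
- by move=> i omega _; rewrite lee_fin coord_energy_ge0.
apply: (@le_trans _ _ (\sum_i (eps * coord_energy A Q b i s + K * rho ^+ 2 / alpha)%:E)%E).
  apply: lee_sum => i _.
  rewrite (integral_step rho b mu0 gamma0 alpha0 diagA a0 gX) lee_fin.
  exact: step_second_moment_le.
rewrite sumEFin lee_fin big_split /= mulr_sumr sumr_const card_ord lerD2l.
by rewrite /C -mulr_natl; lra.
Qed.

(** By invariance, the mean of the truncated energy equals its mean after a step.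
As truncation is concave, the mean over the noise is at most the truncation of
the conditional mean, which the contraction bounds by eps times the energy plus
C. *)
Lemma stationary_energy_le :
  (\int[nu]_s (energy s)%:E <= (2 * C)%:E)%E.
Proof.
apply: (truncated_drift_bound (eps := eps)) => // k k0.
rewrite stationary_integral; last 2 first.
- by apply/measurable_EFinP; exact: measurable_minr.
- by move=> s; rewrite lee_fin le_min k0 energy_ge0.
have mm s : measurable_fun setT (fun omega => Num.min k (energy (step s (X omega)))).
  by apply: (m_after (g := fun s => Num.min k (energy s))); exact: measurable_minr.
apply: ge0_le_integral => //.
- move=> s _; apply: integral_ge0 => omega _.
  by rewrite lee_fin le_min k0 energy_ge0.
- have mz : measurable_fun setT
      (fun z : state * 'cV[R]_n => (Num.min k (energy (step z.1 z.2)))%:E).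
    apply/measurable_EFinP; apply: measurable_minr => //.
    exact: (measurableT_comp menergy mstep).
  rewrite (_ : (fun s => _) =
      fubini_F (law P mX) (fun z => (Num.min k (energy (step z.1 z.2)))%:E)).
    apply: measurable_fun_fubini_tonelli_F => // z.
    by rewrite lee_fin le_min k0 energy_ge0.
  apply/funext => s; rewrite /fubini_F [RHS]ge0_integral_law//.
  + apply/measurable_EFinP; apply: measurable_minr => //.
    exact: (measurableT_comp menergy (measurable_fun_pair2 s mstep)).
  + by move=> u; rewrite lee_fin le_min k0 energy_ge0.
- apply/measurable_EFinP; apply: measurable_minr => //.
  by apply: measurable_funD => //; exact: measurable_funM.
- move=> s _; rewrite EFin_min le_min; apply/andP; split.
    apply: (@le_trans _ _ (\int[P]_omega k%:E)%E).
      apply: ge0_le_integral => //.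
      + by move=> omega _; rewrite lee_fin le_min k0 energy_ge0.
      + exact/measurable_EFinP.
      + by move=> omega _; rewrite lee_fin ge_min lexx.
    by rewrite integral_cst//= probability_setT mule1.
  apply: le_trans (integral_energy_le s); apply: ge0_le_integral => //.
  + by move=> omega _; rewrite lee_fin le_min k0 energy_ge0.
  + exact/measurable_EFinP.
  + by apply/measurable_EFinP; exact: (m_after s menergy).
  + by move=> omega _; rewrite lee_fin ge_min lexx orbT.
Qed.

(** Position after a step is the drift plus independent noise of explicit variance;
D is the mean square of the drift, controlled by the stationary energy. *)
Lemma stationary_position :
  exists2 D : R, 0 <= D <= K / alpha ^+ 2 * (2 * C) &
  (\int[nu]_s (sqnorm (s.1 - xstar A b))%:E =
   (D + \sum_i p i ^+ 2 * alpha * rho ^+ 2)%:E)%E.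
Proof.
have K_drift i s : drift mu gamma alpha A Q a b i s ^+ 2 <=
    K / alpha ^+ 2 * coord_energy A Q b i s.
  apply: le_trans (drift_sqr_le mu0 gamma0 alpha1 (a_mu i) _ _) _.
  rewrite ler_wpM2r ?coord_energy_ge0// ler_wpM2r ?invr_ge0 ?sqr_ge0//.
  have g0 := sqr_ge0 (gamma / mu); have T0 := sqr_ge0 (tau_max mu gamma).
  rewrite /contraction_const.
  by have := mulr_ge0 g0 T0; lra.
pose D := (\int[nu]_s (\sum_i drift mu gamma alpha A Q a b i s ^+ 2)%:E)%E.
have mD : measurable_fun setT (fun s : state => \sum_i drift mu gamma alpha A Q a b i s ^+ 2).
  by apply: measurable_sum => i; apply: measurable_funX; exact: measurable_drift.
have D0 : (0 <= D)%E.
  by apply: integral_ge0 => s _; rewrite lee_fin; apply: sumr_ge0 => i _; exact: sqr_ge0.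
have DC : (D <= (K / alpha ^+ 2 * (2 * C))%:E)%E.
  apply: (@le_trans _ _ (\int[nu]_s ((K / alpha ^+ 2)%:E * (energy s)%:E))%E).
    apply: ge0_le_integral => //.
    - by move=> s _; rewrite lee_fin; apply: sumr_ge0 => i _; exact: sqr_ge0.
    - exact/measurable_EFinP.
    - apply/measurable_EFinP; exact: measurable_funM.
    - move=> s _; rewrite -EFinM lee_fin /energy mulr_sumr; apply: ler_sum => i _.
      exact: K_drift.
  rewrite ge0_integralZl//.
  - by rewrite [leRHS]EFinM lee_wpmul2l ?lee_fin// stationary_energy_le.
  - exact/measurable_EFinP.
  - by move=> s _; rewrite lee_fin.
have Dfin : D \is a fin_num by rewrite ge0_fin_numE// (le_lt_trans DC)// ltry.
exists (fine D).
  by rewrite -!lee_fin fineK// D0.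
have msq : measurable_fun setT (fun s : state => sqnorm (s.1 - xstar A b)).
  under eq_fun do rewrite (sqnorm_eigen_coord b diagA).
  by apply: measurable_sum => i; exact: measurable_funX.
rewrite stationary_integral; last 2 first.
- exact/measurable_EFinP.
- by move=> s; rewrite lee_fin; apply: sumr_ge0 => i _; exact: sqr_ge0.
transitivity (\int[nu]_s ((\sum_i drift mu gamma alpha A Q a b i s ^+ 2)%:E +
   (\sum_i p i ^+ 2 * alpha * rho ^+ 2)%:E))%E.
  apply: eq_integral => s _.
  under eq_integral do rewrite (sqnorm_eigen_coord b diagA) -sumEFin.
  rewrite ge0_integral_sum//; last 2 first.
  - move=> i; apply/measurable_EFinP; apply: measurable_funX.
    exact: (m_after s (mcoord1 i)).
  - by move=> i omega _; rewrite lee_fin sqr_ge0.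
  rewrite -EFinD -big_split /= -sumEFin; apply: eq_bigr => i _.
  by rewrite (integral_step1 rho b mu0 gamma0 alpha0 diagA a0 gX).
rewrite ge0_integralD//.
- by rewrite integral_cst//= probability_setT mule1 EFinD fineK.
- by move=> s _; rewrite lee_fin; apply: sumr_ge0 => i _; exact: sqr_ge0.
- exact/measurable_EFinP.
- move=> s _; rewrite lee_fin; apply: sumr_ge0 => i _.
  by rewrite mulr_ge0 ?sqr_ge0// mulr_ge0 ?sqr_ge0// ltW.
Qed.

End stationary_moments.

(** * The limit of large alpha *)

Section large_alpha.
Context {R : realType}.
Variables (mu gamma : R).
Hypotheses (mu0 : 0 < mu) (gamma0 : 0 < gamma).

Lemma cvg_inv_pinfty : (x^-1 : R) @[x --> +oo] --> (0 : R).
Proof.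
apply/gtr0_cvgV0; last exact: cvg_id.
by exists 0; split => // x.
Qed.

(** Dividing numerator and denominator by alpha turns alpha times the gain into
gamma / (gamma (1 + tau) / alpha + a), where tau stays bounded. *)
Lemma cvg_scaled_gain (a : R) : 0 < a ->
  (alpha * gain mu gamma alpha a) @[alpha --> +oo] --> gamma / a.
Proof.
move=> a0.
apply: (@cvg_trans _ ((gamma / (gamma * (1 + (alpha^-1 + mu / gamma)) * alpha^-1 + a))
    @[alpha --> +oo])).
  apply: near_eq_cvg; near=> alpha.
  have alpha0 : 0 < alpha by near: alpha; apply: nbhs_pinfty_gt; rewrite num_real.
  rewrite /gain /tau.
  have h1 : gamma * (1 + (alpha^-1 + mu / gamma)) + alpha * a != 0.
    by rewrite gt_eqF// addr_gt0// mulr_gt0// !addr_gt0// ?invr_gt0// divr_gt0.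
  have aN0 : alpha != 0 by rewrite gt_eqF.
  move: (gamma * (1 + _)) h1 => s h1.
  have -> : s * alpha^-1 + a = (s + alpha * a) / alpha by field.
  by field; rewrite h1 aN0.
have q0 := cvg_inv_pinfty.
have -> : gamma / a = gamma / (gamma * (1 + (0 + mu / gamma)) * 0 + a).
  by rewrite mulr0 add0r.
apply: cvgM; first exact: cvg_cst.
apply: cvgV; first by rewrite mulr0 add0r gt_eqF.
apply: cvgD; last exact: cvg_cst.
apply: cvgM => //; apply: cvgM; first exact: cvg_cst.
apply: cvgD; first exact: cvg_cst.
by apply: cvgD => //; exact: cvg_cst.
Unshelve. all: end_near.
Qed.

End large_alpha.

(** The inverse of A is diagonalized by the same Q with eigenvalues 1 / a_i, and
the trace is invariant under conjugation. *)
Lemma trace_invmx_sqr (R : realType) n (A Q : 'M[R]_n) (a : 'rV[R]_n) :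
  orthogonal_diagonalization A Q a -> (forall i, 0 < a 0 i) ->
  \tr (invmx A *m invmx A) = \sum_i (a 0 i ^+ 2)^-1.
Proof.
move=> [_ QTQ AE] a0.
have QQT : Q *m Q^T = 1%:M by exact: mulmx1C.
pose D := diag_mx (\row_i (a 0 i)^-1).
pose B := Q *m D *m Q^T.
have aD : diag_mx a *m D = 1%:M.
  apply/matrixP => i j; rewrite mul_diag_mx !mxE.
  by case: eqVneq => _; rewrite ?mulr0n ?mulr0// mulr1n divff// gt_eqF.
have AB : A *m B = 1%:M.
  by rewrite AE /B -!mulmxA (mulmxA Q^T Q) QTQ mul1mx (mulmxA (diag_mx a)) aD mul1mx.
have -> : invmx A = B.
  have uA : A \in unitmx by have [] := mulmx1_unit AB.
  by rewrite -[RHS](mulKmx uA) AB mulmx1.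
rewrite /B -!mulmxA (mulmxA Q^T Q) QTQ mul1mx mxtrace_mulC -!mulmxA QTQ mulmx1.
rewrite /mxtrace; apply: eq_bigr => i _.
by rewrite mul_diag_mx !mxE eqxx !mulr1n -invfM -expr2.
Qed.

Section stationary_limit.
Context d (Omega : measurableType d) (R : realType) (P : probability Omega R).
Context (n : nat) (X : {RV P >-> 'cV[R]_n}).
Variables (mu gamma rho : R) (A Q : 'M[R]_n) (a : 'rV[R]_n) (b : 'cV[R]_n).
Hypotheses (mu0 : 0 < mu) (gamma0 : 0 < gamma).
Hypotheses (diagA : orthogonal_diagonalization A Q a).
Hypothesis a_mu : forall i, mu <= a 0 i.
Hypothesis gX : std_gaussian_vector X.
Local Notation K := (contraction_const mu gamma).
Local Notation state := ('cV[R]_n * 'cV[R]_n)%type.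

(** alpha E |x - xstar|^2 lies between rho^2 times the sum of (alpha p_i)^2 and the
same quantity plus alpha D, which is at most 2 K^2 n rho^2 / alpha. *)
Lemma cvg_stationary_position (nu : R -> probability state R) :
  (\forall alpha \near +oo,
     stationary_law mu gamma alpha rho (quad A b) X (nu alpha)) ->
  (alpha%:E * \int[nu alpha]_s (sqnorm (s.1 - xstar A b))%:E)%E
    @[alpha --> +oo] -->
  (rho ^+ 2 * gamma ^+ 2 * \sum_(i < n) (a 0 i ^+ 2)^-1)%:E.
Proof.
move=> nu_stat.
have a0 i : 0 < a 0 i by exact: lt_le_trans (a_mu i).
pose main (alpha : R) := rho ^+ 2 * \sum_(i < n) (alpha * gain mu gamma alpha (a 0 i)) ^+ 2.
pose c := 2 * K ^+ 2 * (n%:R * rho ^+ 2).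
have c0 : 0 <= c.
  by apply: mulr_ge0; [apply: mulr_ge0 => //; exact: sqr_ge0|apply: mulr_ge0 => //; exact: sqr_ge0].
have main_cvg : main alpha @[alpha --> +oo] -->
    rho ^+ 2 * gamma ^+ 2 * \sum_(i < n) (a 0 i ^+ 2)^-1.
  have -> : rho ^+ 2 * gamma ^+ 2 * \sum_(i < n) (a 0 i ^+ 2)^-1 =
      rho ^+ 2 * \sum_(i < n) (gamma / a 0 i) ^+ 2.
    rewrite -mulrA mulr_sumr; congr (_ * _); apply: eq_bigr => i _.
    by rewrite expr_div_n.
  apply: cvgM; first exact: cvg_cst.
  apply: (cvg_big add_continuous) => i _.
  rewrite expr2; under eq_fun do rewrite expr2.
  by apply: cvgM; exact: cvg_scaled_gain.
have bounds : \forall alpha \near +oo, exists2 y : R,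
    main alpha <= y <= main alpha + c * alpha^-1 &
    (alpha%:E * \int[nu alpha]_s (sqnorm (s.1 - xstar A b))%:E)%E = y%:E.
  near=> alpha.
  have st : stationary_law mu gamma alpha rho (quad A b) X (nu alpha) by near: alpha.
  have alpha1 : 1 <= alpha by near: alpha; apply: nbhs_pinfty_ge; rewrite num_real.
  have aK : 2 * K <= alpha by near: alpha; apply: nbhs_pinfty_ge; rewrite num_real.
  have alpha0 : 0 < alpha by exact: lt_le_trans alpha1.
  have [D /andP[D0 D1] ->] := stationary_position mu0 gamma0 alpha1 diagA a_mu gX aK st.
  exists (alpha * (D + \sum_i gain mu gamma alpha (a 0 i) ^+ 2 * alpha * rho ^+ 2)) => //.
  have -> : alpha * (D + \sum_i gain mu gamma alpha (a 0 i) ^+ 2 * alpha * rho ^+ 2) =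
      main alpha + alpha * D.
    rewrite mulrDr addrC; congr (_ + _); rewrite /main !mulr_sumr.
    by apply: eq_bigr => i _; ring.
  rewrite lerDl mulr_ge0 ?(ltW alpha0)// lerD2l /=.
  apply: (le_trans (ler_wpM2l (ltW alpha0) D1)).
  have -> : alpha * (K / alpha ^+ 2 * (2 * (K * (n%:R * rho ^+ 2) / alpha))) =
     c * alpha^-1 * alpha^-1 by rewrite /c; field; rewrite gt_eqF.
  by rewrite ler_piMr ?invf_le1// mulr_ge0// invr_ge0 ltW.
apply/fine_cvgP; split.
  by near=> alpha; have /(_ _)[//|y _ ->] := near bounds alpha.
apply: (@squeeze_cvgr _ _ _ _ main (fun alpha => main alpha + c * alpha^-1)).
- near=> alpha.
  by have /(_ _)[//|y my /= ->] := near bounds alpha.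
- exact: main_cvg.
- rewrite -[X in _ --> X]addr0 -[X in _ --> _ + X](mulr0 c).
  apply: cvgD => //; apply: cvgM; first exact: cvg_cst.
  exact: cvg_inv_pinfty.
Unshelve. all: end_near.
Qed.

End stationary_limit.

(** * The theorem *)

Theorem proposition3p2 (R : realType) (mu L gamma : R)
    (mu_gt0 : 0 < mu) (mu_le_L : mu <= L) (gamma_gt0 : 0 < gamma) :
  exists (Ci : nat -> R) (G C : R) (theta : R -> R),
  [/\ forall i, 0 < Ci i, 0 < G, 0 < C, Theta_inv theta &
  forall (n : nat) (A Q : 'M[R]_n) (a : 'rV[R]_n) (b : 'cV[R]_n) (rho : R)
    (d : measure_display) (Omega : measurableType d)
    (P : probability Omega R) (eta : nat -> {RV P >-> 'cV[R]_n}),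
  (0 < n)%N ->
  orthogonal_diagonalization A Q a ->
  (forall i, mu <= a 0 i <= L) ->
  iid_std_gaussian eta ->
  (forall (alpha : R) (x0 v0 : 'cV[R]_n), 1 <= alpha ->
    let x k omega := (quad_scheme mu gamma alpha rho A b eta x0 v0 k omega).1 in
    let e := ecoord mu gamma alpha rho A Q b eta x0 v0 in
    let w := wcoord mu gamma alpha rho A Q b eta x0 v0 in
    let Cbar := \big[Num.max/0]_(i < n) Ci i in
    let sigma2 := n%:R * rho ^+ 2 in
    let V (k : nat) : \bar R :=
      ('E_P[fun omega => sqnorm (x k omega - xstar A b)] +
       (theta alpha)%:E *
       'E_P[fun omega => sqnorm (x k.-1 omega - xstar A b)])%E in
    [/\ forall (k : nat) (i : 'I_n),
          cond_expectation_le P (fun omega => (e k omega i 0, w k omega i 0))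
            (fun omega => e k.+1 omega i 0 ^+ 2 + w k.+1 omega i 0 ^+ 2)
            (fun omega => Ci i / alpha ^+ 2 *
                            (e k omega i 0 ^+ 2 + w k omega i 0 ^+ 2) +
                          Ci i * rho ^+ 2 / alpha),
        forall k : nat,
          cond_expectation_le P (fun omega => (e k omega, w k omega))
            (fun omega => sqnorm (e k.+1 omega) + sqnorm (w k.+1 omega))
            (fun omega => Cbar / alpha ^+ 2 *
                            (sqnorm (e k omega) + sqnorm (w k omega)) +
                          Cbar * sigma2 / alpha)
      & forall k : nat, (1 <= k)%N ->
          (V k.+1 <= (G / alpha)%:E * V k + (C * sigma2 / alpha)%:E)%E]) /\
  [/\ \forall alpha \near +oo,
        (forall i, stable (transition_mx mu gamma alpha (a 0 i))) /\
        (exists nu, stationary_law mu gamma alpha rho (quad A b) (eta 0%N) nu),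
      forall nu : R -> probability ('cV[R]_n * 'cV[R]_n)%type R,
        (\forall alpha \near +oo,
           stationary_law mu gamma alpha rho (quad A b) (eta 0%N) (nu alpha)) ->
        (alpha%:E * \int[nu alpha]_s (sqnorm (s.1 - xstar A b))%:E)%E
          @[alpha --> +oo] -->
        (rho ^+ 2 * gamma ^+ 2 * \sum_(i < n) (a 0 i ^+ 2)^-1)%:E
    & rho ^+ 2 * gamma ^+ 2 * \sum_(i < n) (a 0 i ^+ 2)^-1 =
      gamma ^+ 2 / n%:R * (n%:R * rho ^+ 2) * \tr (invmx A *m invmx A)]].

Proof.
have K0 := contraction_const_gt0 mu gamma.
set K := contraction_const mu gamma in K0.
exists (fun=> K), (9 * K + 1), K, (fun alpha => alpha^-1); split => //.
- by rewrite addr_gt0// mulr_gt0.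
- exists 1, 1; split => // alpha alpha1.
  by rewrite mulVf ?lexx// gt_eqF// (lt_le_trans _ alpha1).
move=> n A Q a b rho d Omega P eta n0 diagA a_mu_L eta_iid.
have a_mu i : mu <= a 0 i by have /andP[] := a_mu_L i.
have a0 i : 0 < a 0 i by exact: lt_le_trans (a_mu i).
split.
  move=> alpha x0 v0 alpha1 x e w Cbar sigma2 V.
  (* The constants of all coordinates are equal, and n > 0. *)
  have CbarK : Cbar = K.
    rewrite /Cbar -(prednK n0); elim: n.-1 => [|m IHm].
      by rewrite big_ord_recl big_ord0; apply/max_idPl/ltW.
    by rewrite big_ord_recl IHm maxxx.
  split.
  - move=> k i; exact: (coord_cond_expectation _ _ _ _ mu_gt0 gamma_gt0 alpha1 diagA).
  - by move=> k; rewrite CbarK; exact: (state_cond_expectation_le _ _ _ _ mu_gt0 gamma_gt0 alpha1 diagA).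
  - by move=> k k1; exact: (lyapunov_recursion _ _ _ _ mu_gt0 gamma_gt0 alpha1 diagA).
split.
- near=> alpha.
  have alpha1 : 1 <= alpha by near: alpha; apply: nbhs_pinfty_ge; rewrite num_real.
  have alphaE : 2 * rate_const mu gamma <= alpha.
    by near: alpha; apply: nbhs_pinfty_ge; rewrite num_real.
  split; first by move=> i; exact: stable_transition.
  exact: (stationary_law_exists _ _ mu_gt0 gamma_gt0 alpha1 diagA).
- move=> nu; exact: (cvg_stationary_position mu_gt0 gamma_gt0 diagA a_mu (eta_iid.1 0%N)).
- rewrite (trace_invmx_sqr diagA a0) mulrA; congr (_ * _).
  have nN0 : n%:R != 0 :> R by rewrite pnatr_eq0 -lt0n.
  by field.
Unshelve. all: end_near.
Qed.
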